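(* A convex polyhedron $P\subset\mathbb R^3$ satisfies $\delta(P)=0$ if and only if its antipodal square complex $X(P)$ has the integral homology of $\mathbb{RP}^2$, i.e. $H_i(X(P);\mathbb Z)\cong H_i(\mathbb{RP}^2;\mathbb Z)$ for all $i$.
   Context: A convex polyhedron $P\subset\mathbb R^3$ means a compact full-dimensional convex polytope. Two points of $P$ are antipodal if there are two parallel supporting planes of $P$, one through each point, that contain $P$ between them. $V(P)$ is the number of vertices of $P$; $A(P)$ is the number of unordered pairs of distinct vertices of $P$ that are antipodal; $B(P)$ is the number of unordered pairs of distinct edges of $P$ whose midpoints are antipodal. The antipodal defect is $\delta(P)=V(P)-1-A(P)+B(P)$. The antipodal graph $G_A(P)$ has as vertices the vertices of $P$, with an edge $vw$ whenever $v,w$ are distinct antipodal vertices. The antipodal square complex $X(P)$ is the two-dimensional finite CW complex obtained from $G_A(P)$ by attaching one square 2-cell for every unordered pair $\{e,f\}$ of distinct edges of $P$ whose midpoints are antipodal: if $e=vv'$ and $f=ww'$, the square is attached along the four-cycle $v-w-v'-w'-v$ (such $e,f$ are disjoint, so the four vertices are distinct, and the four vertex pairs used are antipodal). Different edge pairs giving the same boundary cycle still give distinct 2-cells. *)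

(* Defs.v *)
From HB Require Import structures.
From mathcomp Require Import all_boot all_order all_algebra finmap.
From mathcomp Require Import ring_quotient lra.
From mathcomp Require Import all_classical all_reals all_analysis.

Set Implicit Arguments.
Unset Strict Implicit.
Unset Printing Implicit Defensive.

Import Order.TTheory GRing.Theory Num.Theory numFieldNormedType.Exports.

Local Open Scope classical_set_scope.
Local Open Scope fset_scope.
Local Open Scope ring_scope.

Record chain_complex := ChainComplex {
  chain :> nat -> zmodType;
  bd : forall n, {additive chain n.+1 -> chain n};
  bd_bd : forall n (c : chain n.+2), bd n (bd n.+1 c) = 0 }.

Section Homology.
Variables (C : chain_complex) (n : nat).

(* C 0 is mapped to 0, so that every 0-chain is a cycle. *)
Definition bd_out : {additive C n -> C n.-1} :=
  match n return {additive C n -> C n.-1} with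
  | 0 => \0
  | m.+1 => bd C m
  end.

Definition cycle_pred : {pred C n} := [pred c | bd_out c == 0].

Lemma cycle_closed : zmod_closed cycle_pred.
Proof.
split=> [|x y]; rewrite !inE ?raddf0// => /eqP x0 /eqP y0.
by rewrite raddfB x0 y0 subr0.
Qed.

HB.instance Definition _ :=
  GRing.isZmodClosed.Build (C n) cycle_pred cycle_closed.

Record cycles := Cycle { cycle_val :> C n; cycle_valP : cycle_val \in cycle_pred }.

HB.instance Definition _ := [isSub for cycle_val].
HB.instance Definition _ := [Choice of cycles by <:].
HB.instance Definition _ := [SubChoice_isSubZmodule of cycles by <:].

Definition boundary_pred : {pred cycles} :=
  [pred z : cycles | `[< exists c, (z : C n) = bd C n c >]].

Lemma boundary_closed : zmod_closed boundary_pred.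
Proof.
split=> [|x y]; first by apply/asboolP; exists 0; rewrite raddf0.
move=> /asboolP[c xc] /asboolP[d yd]; apply/asboolP; exists (c - d).
by rewrite !raddfB /= xc yd.
Qed.

HB.instance Definition _ :=
  GRing.isZmodClosed.Build cycles boundary_pred boundary_closed.

Definition homology : zmodType := Quotient.quot boundary_pred.

End Homology.

Definition zmod_iso (A B : zmodType) : Prop :=
  exists f : {additive A -> B}, bijective f.

(* [(e, true)] is the 1-cell [e] traversed from its source to its target,
   [(e, false)] is [e] traversed backwards. *)
Section Darts.
Variables (V E : Type) (src tgt : E -> V).
Definition dart_start (a : E * bool) : V := if a.2 then src a.1 else tgt a.1.
Definition dart_end (a : E * bool) : V := if a.2 then tgt a.1 else src a.1.
End Darts.

(* A finite two-dimensional CW complex whose 2-cells are attached along closed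
   edge paths of the 1-skeleton, which is an arbitrary finite multigraph with
   loops allowed.  The orientations of the 1-cells are auxiliary. *)
Record cw2 := CW2 {
  vert : finType;
  edge : finType;
  face : finType;
  src : edge -> vert;
  tgt : edge -> vert;
  attach : face -> seq (edge * bool);
  attach_neq0 : forall f, attach f != [::];
  attach_closed : forall f,
    cycle (fun a b => dart_end src tgt a == dart_start src tgt b) (attach f) }.

Section CellularChains.
Variable X : cw2.

Definition cell (n : nat) : finType :=
  match n with
  | 0 => vert X
  | 1 => edge X
  | 2 => face X
  | _ => void
  end.

Definition incidence (n : nat) : cell n.+1 -> cell n -> int :=
  match n return cell n.+1 -> cell n -> int with
  | 0 => fun e v => (tgt e == v)%:R - (src e == v)%:R
  | 1 => fun f e => \sum_(a <- attach f | a.1 == e) (if a.2 then 1 else -1)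
  | _.+2 => fun c _ => match c with end
  end.

Definition cell_bd n (c : {ffun cell n.+1 -> int}) : {ffun cell n -> int} :=
  [ffun x => \sum_y c y * incidence y x].

Lemma cell_bd_additive n : zmod_morphism (@cell_bd n).
Proof.
move=> c d; apply/ffunP=> x; rewrite !ffunE -sumrB.
by apply: eq_bigr => y _; rewrite !ffunE mulrBl.
Qed.

HB.instance Definition _ n :=
  GRing.isZmodMorphism.Build _ _ (@cell_bd n) (@cell_bd_additive n).

Lemma incidence_comp n (z : cell n.+2) (x : cell n) :
  \sum_y incidence z y * incidence y x = 0.
Proof.
case: n z x => [|[|n]] /= f v; [|by case: (f : void)..].
pose g (u : vert X) : int := (u == v)%:R.
pose st := dart_start (@src X) (@tgt X); pose en := dart_end (@src X) (@tgt X).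
transitivity (\sum_(a <- attach f) (g (en a) - g (st a))).
  under eq_bigr do rewrite mulr_suml.
  rewrite (exchange_big_dep predT)//=; apply: eq_bigr => -[e b] _ /=.
  rewrite (big_pred1 e) => [|y]; last by rewrite eq_sym.
  by rewrite /st /en; case: b; rewrite /dart_start /dart_end ?mul1r// mulN1r opprB.
have := attach_closed f; case: (attach f) => [|a w] /=; first by rewrite big_nil.
suff H : forall a w b, path (fun x y => en x == st y) a (rcons w b) ->
    \sum_(x <- a :: w) (g (en x) - g (st x)) = g (st b) - g (st a).
  by move/H => ->; rewrite subrr.
move=> {a}b {w}w; elim: w b => [|c w IH] a b /=; rewrite big_cons.
  by rewrite big_nil addr0 andbT => /eqP ->.
by case/andP=> /eqP -> /IH ->; rewrite addrC subrKA.
Qed.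

Lemma cell_bd_bd n (c : {ffun cell n.+2 -> int}) : cell_bd (cell_bd c) = 0.
Proof.
apply/ffunP=> x; rewrite !ffunE.
under eq_bigr do rewrite ffunE mulr_suml.
rewrite exchange_big big1//= => z _.
by under eq_bigr do rewrite -mulrA; rewrite -mulr_sumr incidence_comp mulr0.
Qed.

Definition cellular_chains : chain_complex :=
  @ChainComplex (fun n => {ffun cell n -> int}) (fun n => @cell_bd n) cell_bd_bd.

End CellularChains.

(* The homology of a CW complex is taken to be its cellular homology. *)
Definition integral_homology (X : cw2) (i : nat) : zmodType :=
  homology (cellular_chains X) i.

(* One cell in each dimension 0, 1, 2; the 2-cell wraps twice around the
   circle. *)
Definition RP2 : cw2 :=
  @CW2 unit unit unit id id
    (fun _ => [:: (tt, true); (tt, true)]) (fun _ => isT) (fun _ => isT).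

Section Polyhedra.
Variable R : realType.
Local Notation point := 'rV[R]_3.

Definition dotp (u x : point) : R := (u *m x^T) 0 0.

Definition conv_fset (S : {fset point}) : set point :=
  [set x | exists l : point -> R,
    [/\ forall s, s \in S -> 0 <= l s,
        \sum_(s <- S) l s = 1 &
        x = \sum_(s <- S) l s *: s]].

(* Compactness is automatic for the convex hull of a finite set. *)
Definition convex_polyhedron (P : set point) : Prop :=
  (exists S, P = conv_fset S) /\ P^° !=set0.

Definition segment (v w : point) : set point :=
  [set x | exists t : R, [/\ 0 <= t, t <= 1 & x = (1 - t) *: v + t *: w]].

Definition is_face (P F : set point) : Prop :=
  exists (u : point) (c : R),
    (forall x, P x -> dotp u x <= c) /\ F = [set x | P x /\ dotp u x = c].

Definition is_vertex (P : set point) (v : point) : Prop := is_face P [set v].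

(* An edge is encoded by the set of its two endpoints. *)
Definition is_edge (P : set point) (e : {fset point}) : Prop :=
  exists v w, [/\ e = [fset v; w], v != w, is_vertex P v, is_vertex P w &
                  is_face P (segment v w)].

Definition midpoint (e : {fset point}) : point := 2^-1 *: \sum_(v <- e) v.

(* The two parallel supporting planes are [dotp u z = a] and [dotp u z = b]. *)
Definition antipodal (P : set point) (x y : point) : Prop :=
  exists (u : point) (a b : R),
    [/\ u != 0, forall z, P z -> a <= dotp u z <= b,
        P x /\ dotp u x = a & P y /\ dotp u y = b].

Definition vertex_set (P : set point) : {fset point} :=
  fset_set [set v | is_vertex P v].

Definition edge_set (P : set point) : {fset {fset point}} :=
  fset_set [set e | is_edge P e].

Definition antipodal_vertex_pairs (P : set point) : {fset {fset point}} :=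
  fset_set [set p | exists v w,
    [/\ v \in vertex_set P, w \in vertex_set P, v != w, antipodal P v w &
        p = [fset v; w]]].

Definition antipodal_edge_pairs (P : set point) : {fset {fset {fset point}}} :=
  fset_set [set q | exists e f,
    [/\ e \in edge_set P, f \in edge_set P, e != f,
        antipodal P (midpoint e) (midpoint f) & q = [fset e; f]]].

Definition antipodal_defect (P : set point) : int :=
  #|` vertex_set P|%:Z - 1 - #|` antipodal_vertex_pairs P|%:Z
  + #|` antipodal_edge_pairs P|%:Z.

Section Finiteness.
Variables (P : set point) (hP : convex_polyhedron P).

Lemma dotp_suml (u : point) (S : seq point) (l : point -> R) :
  dotp u (\sum_(s <- S) l s *: s) = \sum_(s <- S) l s * dotp u s.
Proof.
elim: S => [|s S IH]; first by rewrite !big_nil /dotp trmx0 mulmx0 mxE.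
rewrite !big_cons -IH /dotp linearD /= mulmxDr mxE; congr (_ + _).
by rewrite linearZ /= -scalemxAr mxE.
Qed.

Lemma sub_conv_fset (S : {fset point}) s : s \in S -> conv_fset S s.
Proof.
move=> sS; exists (fun t => (t == s)%:R); split => [t _||].
- exact: ler0n.
- by rewrite (big_fsetD1 s) //= eqxx big_seq big1 ?addr0// => t; rewrite !inE => /andP[/negPf ->].
- rewrite (big_fsetD1 s) //= eqxx scale1r big_seq big1 ?addr0// => t.
  by rewrite !inE => /andP[/negPf -> _]; rewrite scale0r.
Qed.

Lemma finite_vertices : finite_set [set v | is_vertex P v].
Proof.
case: hP => -[S ->] _; apply: (@sub_finite_set _ _ [set` S]); last exact: finite_fset.
move=> v /= [u [c [le_c vE]]].
have [Sv uv] : conv_fset S v /\ dotp u v = c.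
  by have : [set v] v by []; rewrite vE.
case: Sv => l [l0 l1 vl].
have [s /andP[sS ls]] : exists s, (s \in S) && (0 < l s).
  apply: contrapT => /forallNP H; move: l1; rewrite big_seq big1.
    by move/esym/eqP; rewrite oner_eq0.
  move=> s sS; apply/eqP; have /negP := H s; rewrite sS/= lt_def l0// andbT.
  by move/negPn.
suff <- : s = v by [].
suff : [set x | conv_fset S x /\ dotp u x = c] s by rewrite -vE.
split; first exact: sub_conv_fset.
have H0 : \sum_(t <- S) l t * (c - dotp u t) = 0.
  under eq_bigr do rewrite mulrBr.
  by rewrite sumrB -mulr_suml l1 mul1r -dotp_suml -vl uv subrr.
have {}H0 : l s * (c - dotp u s) = 0.
  have ge0 t : t \in S -> 0 <= l t * (c - dotp u t).
    move=> tS; rewrite mulr_ge0 ?l0// subr_ge0; apply: le_c; exact: sub_conv_fset.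
  apply/eqP; rewrite eq_le ge0// andbT -H0 (big_fsetD1 s)//= lerDl.
  by rewrite big_seq sumr_ge0// => t; rewrite !inE => /andP[_ /ge0].
by move/eqP: H0; rewrite mulf_eq0 (gt_eqF ls) /= subr_eq0 => /eqP.
Qed.

Lemma vertex_setP v : reflect (is_vertex P v) (v \in vertex_set P).
Proof. by rewrite in_fset_set; [exact: asboolP|exact: finite_vertices]. Qed.

Lemma finite_pairs (T : choiceType) (A : {fset T}) (B : set {fset T}) :
  (forall p, B p -> exists v w, [/\ v \in A, w \in A & p = [fset v; w]]) ->
  finite_set B.
Proof.
move=> H; apply: (@sub_finite_set _ _ [set` fpowerset A]); last exact: finite_fset.
move=> p /H[v [w [vA wA ->]]] /=; rewrite fpowersetE.
by apply/fsubsetP => x; rewrite !inE => /orP[] /eqP ->.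
Qed.

Lemma edge_setP e : reflect (is_edge P e) (e \in edge_set P).
Proof.
rewrite in_fset_set; first exact: asboolP.
apply: (@finite_pairs _ (vertex_set P)) => p [v [w [-> _ /vertex_setP vP /vertex_setP wP _]]].
by exists v, w.
Qed.

Lemma antipodal_vertex_pairsP p :
  reflect (exists v w, [/\ v \in vertex_set P, w \in vertex_set P, v != w,
                           antipodal P v w & p = [fset v; w]])
          (p \in antipodal_vertex_pairs P).
Proof.
rewrite in_fset_set; first exact: asboolP.
by apply: (@finite_pairs _ (vertex_set P)) => q [v [w [vP wP _ _ ->]]]; exists v, w.
Qed.

Lemma antipodal_edge_pairsP q :
  reflect (exists e f, [/\ e \in edge_set P, f \in edge_set P, e != f,
                           antipodal P (midpoint e) (midpoint f) & q = [fset e; f]])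
          (q \in antipodal_edge_pairs P).
Proof.
rewrite in_fset_set; first exact: asboolP.
by apply: (@finite_pairs _ (edge_set P)) => r [v [w [vP wP _ _ ->]]]; exists v, w.
Qed.

Lemma midpointE (v w : point) : v != w -> midpoint [fset v; w] = 2^-1 *: (v + w).
Proof. by move=> vw; rewrite /midpoint big_fsetU1 ?inE//= big_seq_fset1. Qed.

Lemma vertex_in v : is_vertex P v -> P v.
Proof. by case=> u [c [_ E]]; have : [set v] v by []; rewrite E => -[]. Qed.

Lemma dotp_midpoint u v w : dotp u (2^-1 *: (v + w)) = 2^-1 * (dotp u v + dotp u w).
Proof. by rewrite /dotp linearZ /= linearD /= -scalemxAr mulmxDr !mxE. Qed.

Lemma width_gt0 (u : point) (a : R) :
  u != 0 -> (forall z, P z -> dotp u z = a) -> False.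
Proof.
move=> u0 Pa; case: hP => _ [x /= xP].
have cvg : (fun t : R => x + t *: u) @ (0 : R) --> x.
  rewrite -[X in _ --> X]addr0; apply: cvgD; first exact: cvg_cst.
  rewrite -[X in _ --> X](scale0r u); apply: cvgZr_tmp; exact: cvg_id.
have /nbhs_ballP[e /= e0 He] : \forall t \near (0 : R), P (x + t *: u) by exact: cvg xP.
have Px : P x by exact: nbhs_singleton xP.
have Pe : P (x + (e / 2) *: u).
  apply: (He (e / 2)); rewrite /ball/= sub0r normrN gtr0_norm ?divr_gt0//.
  by rewrite ltr_pdivrMr// ltr_pMr// ltr1n.
have := Pa _ Pe; rewrite -(Pa _ Px) /dotp linearD linearZ /= mulmxDr -scalemxAr.
rewrite !mxE => /(canRL (addKr _)); rewrite addNr => /eqP.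
rewrite mulf_eq0 gt_eqF ?divr_gt0//= psumr_eq0 => [/allP H|i _]; last first.
  by rewrite mxE -expr2 sqr_ge0.
case/eqP: u0; apply/rowP => i; have := H i (mem_index_enum _).
by rewrite !mxE mulf_eq0 orbb => /eqP.
Qed.

Lemma antipodal_edges_vertices v v' w w' :
  is_edge P [fset v; v'] -> v != v' -> is_edge P [fset w; w'] -> w != w' ->
  antipodal P (midpoint [fset v; v']) (midpoint [fset w; w']) ->
  forall x y, x \in [fset v; v'] -> y \in [fset w; w'] ->
  [/\ x \in vertex_set P, y \in vertex_set P, x != y & antipodal P x y].
Proof.
move=> Ev vv' Ew ww' [u [a [b [u0 slab []]]]].
rewrite !midpointE// !dotp_midpoint => _ va [_ wb].
have edgeV e x : is_edge P e -> x \in e -> is_vertex P x.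
  by case=> s [t [-> _ sP tP _]]; rewrite !inE => /orP[] /eqP ->.
have slabV e x : is_edge P e -> x \in e -> (a <= dotp u x <= b) /\ P x.
  by move=> eP xe; have := vertex_in (edgeV _ _ eP xe) => xP; split; [exact: slab|].
have [Av Pv] := slabV _ v Ev (fset21 _ _); have [Av' Pv'] := slabV _ v' Ev (fset22 _ _).
have [Bw Pw] := slabV _ w Ew (fset21 _ _); have [Bw' Pw'] := slabV _ w' Ew (fset22 _ _).
have Eva : dotp u v = a by lra.
have Eva' : dotp u v' = a by lra.
have Ewb : dotp u w = b by lra.
have Ewb' : dotp u w' = b by lra.
move=> x y xe ye.
have xa : dotp u x = a by move: xe; rewrite !inE => /orP[] /eqP ->.
have yb : dotp u y = b by move: ye; rewrite !inE => /orP[] /eqP ->.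
have [_ Px] := slabV _ _ Ev xe; have [_ Py] := slabV _ _ Ew ye.
split.
- by apply/vertex_setP; exact: edgeV xe.
- by apply/vertex_setP; exact: edgeV ye.
- apply/eqP => xy; apply: (@width_gt0 u a u0) => z /slab.
  by rewrite -yb -xy xa -eq_le => /eqP.
- by exists u, a, b; split.
Qed.

End Finiteness.

Section SquareComplex.
Variables (P : set point) (hP : convex_polyhedron P).

Local Notation sc_vert := (vertex_set P : finType).
Local Notation sc_edge := (antipodal_vertex_pairs P : finType).
Local Notation sc_face := (antipodal_edge_pairs P : finType).

Lemma orientation_exists (p : sc_edge) :
  exists vw : sc_vert * sc_vert,
    vw.1 != vw.2 /\ val p = [fset val vw.1; val vw.2].
Proof.
have /antipodal_vertex_pairsP[v [w [vP wP vw _ E]]] := valP p.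
by exists ([` vP], [` wP]).
Qed.

(* An arbitrary orientation of each edge of the antipodal graph. *)
Definition sc_orient (p : sc_edge) : sc_vert * sc_vert :=
  sval (cid (orientation_exists p)).
Definition sc_src (p : sc_edge) : sc_vert := (sc_orient p).1.
Definition sc_tgt (p : sc_edge) : sc_vert := (sc_orient p).2.

(* [w] runs through the four-cycle v - w - v' - w' - v, where vv' and ww' are
   the two edges of P in the pair [q]. *)
Definition square_boundary (q : sc_face) (w : seq (sc_edge * bool)) : Prop :=
  exists x x' y y' : sc_vert,
    [/\ val q = [fset [fset val x; val x']; [fset val y; val y']],
        [seq dart_start sc_src sc_tgt a | a <- w] = [:: x; y; x'; y'] &
        [seq dart_end sc_src sc_tgt a | a <- w] = [:: y; x'; y'; x]].

Lemma dart_exists (x y : sc_vert) : x != y -> antipodal P (val x) (val y) ->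
  exists a : sc_edge * bool,
    dart_start sc_src sc_tgt a = x /\ dart_end sc_src sc_tgt a = y.
Proof.
move=> xy Axy.
have pP : [fset val x; val y] \in antipodal_vertex_pairs P.
  by apply/antipodal_vertex_pairsP; exists (val x), (val y); split; rewrite ?fsvalP.
pose p : sc_edge := [` pP]; case: (svalP (cid (orientation_exists p))).
rewrite -/(sc_orient p) -/(sc_src p) -/(sc_tgt p) /= => neq E.
have Es : val (sc_src p) \in [fset val x; val y] by rewrite E fset21.
have Et : val (sc_tgt p) \in [fset val x; val y] by rewrite E fset22.
move: Es Et neq; rewrite !inE !val_eqE.
case/orP=> /eqP Es /orP[] /eqP Et; rewrite ?Es ?Et ?eqxx// => _.
- by exists (p, true).
- by exists (p, false).
Qed.

Lemma antipodal_sym x y : antipodal P x y -> antipodal P y x.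
Proof.
have dN (u z : point) : dotp (- u) z = - dotp u z by rewrite /dotp mulNmx mxE.
case=> u [a [b [u0 slab [Px xa] [Py yb]]]]; exists (- u), (- b), (- a).
rewrite oppr_eq0 !dN xa yb; split=> // z /slab.
by rewrite dN !lerN2 andbC.
Qed.

Lemma square_boundary_exists (q : sc_face) : exists w, square_boundary q w.
Proof.
have /antipodal_edge_pairsP[e [f [/(edge_setP hP) eP /(edge_setP hP) fP ef Aef E]]] := valP q.
have [v [v' [Ee vv' _ _ _]]] := eP; have [w [w' [Ef ww' _ _ _]]] := fP.
rewrite {}Ee in eP E Aef {ef}; rewrite {}Ef in fP E Aef.
have H := antipodal_edges_vertices hP eP vv' fP ww' Aef.
have [vP wP nvw Avw] := H v w (fset21 _ _) (fset21 _ _).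
have [_ _ nv'w Av'w] := H v' w (fset22 _ _) (fset21 _ _).
have [v'P w'P nv'w' Av'w'] := H v' w' (fset22 _ _) (fset22 _ _).
have [_ _ nvw' Avw'] := H v w' (fset21 _ _) (fset22 _ _).
pose x : sc_vert := [` vP]; pose x' : sc_vert := [` v'P].
pose y : sc_vert := [` wP]; pose y' : sc_vert := [` w'P].
have [a1 [s1 e1]] := @dart_exists x y nvw Avw.
have [a2 [s2 e2]] := @dart_exists y x' (contraNN (fun h => etrans (eq_sym _ _) h) nv'w) (antipodal_sym Av'w).
have [a3 [s3 e3]] := @dart_exists x' y' nv'w' Av'w'.
have [a4 [s4 e4]] := @dart_exists y' x (contraNN (fun h => etrans (eq_sym _ _) h) nvw') (antipodal_sym Avw').
exists [:: a1; a2; a3; a4], x, x', y, y'.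
by rewrite /= s1 s2 s3 s4 e1 e2 e3 e4.
Qed.

Definition sc_attach (q : sc_face) : seq (sc_edge * bool) :=
  sval (cid (square_boundary_exists q)).

Lemma sc_attachP q : square_boundary q (sc_attach q).
Proof. exact: svalP (cid (square_boundary_exists q)). Qed.

Lemma sc_attach_neq0 q : sc_attach q != [::].
Proof. by case: (sc_attachP q) => x [x' [y [y' [_]]]]; case: sc_attach. Qed.

Lemma sc_attach_closed q :
  cycle (fun a b => dart_end sc_src sc_tgt a == dart_start sc_src sc_tgt b)
        (sc_attach q).
Proof.
case: (sc_attachP q) => x [x' [y [y' [_]]]].
case: sc_attach => [|a [|b [|c [|d []]]]] //= [-> -> -> ->] [-> -> -> ->].
by rewrite !eqxx.
Qed.

Definition square_complex : cw2 :=
  @CW2 sc_vert sc_edge sc_face sc_src sc_tgt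
    sc_attach sc_attach_neq0 sc_attach_closed.

End SquareComplex.

End Polyhedra.

(* Main.v *)
(** Write G(u) for the set of vertices of P maximizing the functional u, so that
    v and w are antipodal iff v lies in G(u) and w in G(-u) for some u <> 0.
    Everything is a consequence of the topology of the sphere of directions:
    for u near u0 one has G(u) included in G(u0), and G(u) is connected through
    the edges of P it contains.

    Let phi be a 1-cocycle of X(P) with values in an abelian group, viewed as an
    antisymmetric function of antipodal pairs.  The square relations give
    phi(v,w) = a(v) + b(w) on each product G(u) x G(-u), with a and b unique up
    to constants there.  These local potentials glue over the (simply connected)
    sphere, so that phi(v,w) = alpha(v) + beta(w) globally, and antisymmetry
    then forces phi(v,w) = alpha(v) - alpha(w) + c with 2c = 0.  Taking values in
    the 1-chains modulo boundaries gives H_1(X(P)) = Z/2, the odd cycle coming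
    from a path of directions from u to -u.  So H_0 and H_1 always agree with
    those of the projective plane; the Euler characteristic of X(P) being
    1 + delta(P), the remaining group H_2 vanishes iff delta(P) = 0. *)

From HB Require Import structures.
Require Import Defs.
From mathcomp Require Import all_boot all_order all_algebra finmap.
From mathcomp Require Import generic_quotient ring_quotient lra ring zify.
From mathcomp Require Import all_classical all_reals all_analysis.

Set Implicit Arguments.
Unset Strict Implicit.
Unset Printing Implicit Defensive.

Import Order.TTheory GRing.Theory Num.Theory.

Local Open Scope ring_scope.

(** * Functionals on finite point sets *)

Lemma finite_lower_bound (R : realFieldType) (I : finType) (Q : pred I)
    (f : I -> R) :
  (forall i, Q i -> 0 < f i) ->
  exists e, 0 < e /\ forall i, Q i -> e <= f i.
Proof.
move=> f0; exists (\big[Order.min/1]_(i | Q i) f i); split.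
  by apply: (big_ind (fun x => 0 < x)) => // x y x0 y0; rewrite lt_min x0.
by move=> i Qi; exact: bigmin_le_cond.
Qed.

Lemma finite_upper_bound (R : realFieldType) (I : finType) (f : I -> R) :
  exists M, 0 < M /\ forall i, f i <= M.
Proof.
exists (1 + \sum_i `|f i|); split=> [|i].
  by rewrite ltr_pwDl// sumr_ge0.
rewrite (bigD1 i)//=; apply: (le_trans (ler_norm _)).
rewrite addrCA lerDl addr_ge0// ?ler01// sumr_ge0// => j _; exact: normr_ge0.
Qed.

(** Continuous induction using upper semicontinuity alone: for [t] near [t0] the members of [K t]
    belong to [K t0]. The supremum [s] of the times whose members are all related to [x] is itself
    such a time, through a member of [K t] with [t] just below [s]. It cannot be below 1, since
    members at times just after [s] already lie in [K s]. *)
Lemma sweep (R : realType) (T : Type) (K : R -> T -> Prop) (E : T -> T -> Prop) :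
  (forall x y z, E x y -> E y z -> E x z) ->
  (forall t, 0 <= t <= 1 -> exists x, K t x) ->
  (forall t x y, 0 <= t <= 1 -> K t x -> K t y -> E x y) ->
  (forall t0, 0 <= t0 <= 1 -> exists e, 0 < e /\
     forall t, 0 <= t <= 1 -> `|t - t0| < e -> forall x, K t x -> K t0 x) ->
  forall x y, K 0 x -> K 1 y -> E x y.
Proof.
move=> Etr Kn KE Kloc x y K0x K1y.
pose S := [set t : R | 0 <= t <= 1 /\ forall z, K t z -> E x z]%classic.
have S0 : S 0 by split=> [|z]; [rewrite lexx ler01|apply: KE; rewrite ?lexx ?ler01].
have Sub : ubound S 1 by move=> t [/andP[]].
have Ss : has_sup S by split; [exists 0|exists 1].
pose s := sup S.
have s1 : s <= 1 by apply: ge_sup => //; exists 0.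
have s0 : 0 <= s by apply: ub_le_sup => //; exists 1.
have s01 : 0 <= s <= 1 by rewrite s0 s1.
have [e [e0 He]] := Kloc s s01.
have SS : S s.
  split=> // z Kz.
  have [t [t01 Ht] ts] := sup_adherent e0 Ss.
  have tles : t <= s by apply: ub_le_sup; [exists 1|].
  have [w Kw] := Kn t t01.
  apply: (Etr _ w); first exact: Ht.
  apply: (KE s) => //; apply: (He t) => //.
  by rewrite ler0_norm ?subr_le0// opprB ltrBlDr addrC -ltrBlDr.
case: (leP 1 s) => [s1'|s1'].
  have E1 : s = 1 by apply/eqP; rewrite eq_le s1.
  by move: SS; rewrite E1 => -[_]; apply.
pose t := Num.min 1 (s + e / 2).
have st : s < t by rewrite lt_min s1' ltrDl divr_gt0.
have t01 : 0 <= t <= 1 by rewrite (le_trans s0 (ltW st)) ge_min lexx.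
suff : S t by move=> St; have := ub_le_sup (ex_intro _ _ Sub) St; rewrite leNgt st.
split=> // z Kz; case: SS => _; apply; apply: (He t) => //.
rewrite gtr0_norm ?subr_gt0// ltrBlDl /t.
by apply: (le_lt_trans (y := s + e / 2)); [rewrite ge_min lexx orbT|lra].
Qed.

(** * The scalar product and generic functionals *)

Section Dotp.
Variable R : realType.
Implicit Types u w x y : 'rV[R]_3.

Lemma dotpC u x : dotp u x = dotp x u.
Proof.
have -> : dotp u x = (u *m x^T)^T 0 0 by rewrite mxE.
by rewrite trmx_mul trmxK.
Qed.

Lemma dotpDl u w x : dotp (u + w) x = dotp u x + dotp w x.
Proof. by rewrite /dotp mulmxDl mxE. Qed.

Lemma dotpZl (a : R) u x : dotp (a *: u) x = a * dotp u x.
Proof. by rewrite /dotp -scalemxAl mxE. Qed.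

Lemma dotpNl u x : dotp (- u) x = - dotp u x.
Proof. by rewrite -scaleN1r dotpZl mulN1r. Qed.

Lemma dotpBl u w x : dotp (u - w) x = dotp u x - dotp w x.
Proof. by rewrite dotpDl dotpNl. Qed.

Lemma dotp0l x : dotp 0 x = 0.
Proof. by rewrite -(scale0r 0) dotpZl mul0r. Qed.

Lemma dotpDr u x y : dotp u (x + y) = dotp u x + dotp u y.
Proof. by rewrite !(dotpC u) dotpDl. Qed.

Lemma dotpZr (a : R) u x : dotp u (a *: x) = a * dotp u x.
Proof. by rewrite !(dotpC u) dotpZl. Qed.

Lemma dotpBr u x y : dotp u (x - y) = dotp u x - dotp u y.
Proof. by rewrite !(dotpC u) dotpBl. Qed.

Lemma dotp_gt0 u : u != 0 -> 0 < dotp u u.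
Proof.
move=> u0; have -> : dotp u u = \sum_i u 0 i ^+ 2.
  by rewrite /dotp mxE; apply: eq_bigr => i _; rewrite mxE expr2.
rewrite lt_def sumr_ge0 ?andbT => [|i _]; last exact: sqr_ge0.
rewrite psumr_eq0 => [|i _]; last exact: sqr_ge0.
apply/negP => /allP H; case/eqP: u0; apply/rowP => i.
by have := H i (mem_index_enum _); rewrite sqrf_eq0 mxE => /eqP.
Qed.

Lemma orthogonal_exists u w : exists z, [/\ z != 0, dotp z u = 0 & dotp z w = 0].
Proof.
pose M := col_mx u w.
have : kermx M^T != 0.
  rewrite -mxrank_eq0 mxrank_ker -lt0n subn_gt0 mxrank_tr.
  by apply: leq_ltn_trans (rank_leq_row _) _.
case/rowV0Pn => z /sub_kermxP; rewrite /M tr_col_mx mul_mx_row => zM z0.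
have [zu zw] : z *m u^T = 0 /\ z *m w^T = 0.
  by move: zM; rewrite -[0 in RHS]row_mx0 => /eq_row_mx.
by exists z; split=> //; rewrite /dotp ?zu ?zw mxE.
Qed.

(** Induction on the list: if [h] vanishes on the new vector [d], it is replaced by [h + e *: d],
    with [e] too small to cancel any of the earlier nonzero values. *)
Lemma separating_functional (s : seq 'rV[R]_3) :
  (forall d, d \in s -> d != 0) -> exists h, forall d, d \in s -> dotp h d != 0.
Proof.
elim: s => [|d s IH] s0; first by exists 0.
have [h Hh] := IH (fun x xs => s0 x (mem_behead (s := d :: s) xs)).
have d0 := s0 d (mem_head _ _).
case: (eqVneq (dotp h d) 0) => [hd|hd]; last first.
  by exists h => x; rewrite inE => /predU1P[->//|/Hh].
have [e [e0 He]] : exists e, 0 < e /\ forall x : seq_sub s,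
    true -> e <= `|dotp h (val x)| / (1 + `|dotp d (val x)|).
  apply: finite_lower_bound => x _; apply: divr_gt0; last by rewrite ltr_pwDl.
  by rewrite normr_gt0; apply: Hh; exact: ssvalP.
exists (h + e *: d) => x; rewrite inE dotpDl dotpZl => /predU1P[->|xs].
  by rewrite hd add0r mulf_neq0 ?gt_eqF ?dotp_gt0.
have := He (SeqSub xs) isT; rewrite /= ler_pdivlMr ?ltr_pwDl// => ex.
apply/eqP => /eqP; rewrite addr_eq0 => /eqP E; move: ex.
by rewrite E normrN normrM (gtr0_norm e0) mulrDr mulr1 gerDr leNgt e0.
Qed.

End Dotp.

(** * Exposed faces, their semicontinuity and their connectedness *)

Section Maximizers.
Variables (R : realType) (T : finType) (p : T -> 'rV[R]_3).
Implicit Types (u h : 'rV[R]_3) (v w : T).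

(** The points on the face of the convex hull with outer normal [u]; all points when [u] is 0. *)
Definition maximizers u : {set T} :=
  [set v | [forall w, dotp u (p w) <= dotp u (p v)]].
Local Notation G := maximizers.

Lemma maximizersP u v :
  reflect (forall w, dotp u (p w) <= dotp u (p v)) (v \in G u).
Proof. by rewrite inE; exact: forallP. Qed.

Lemma maximizersNP u v :
  reflect (forall w, dotp u (p v) <= dotp u (p w)) (v \in G (- u)).
Proof.
apply: (iffP (maximizersP _ _)) => H w; have := H w;
  by rewrite !dotpNl lerN2.
Qed.

Lemma maximizers_eq u v w :
  v \in G u -> w \in G u -> dotp u (p v) = dotp u (p w).
Proof. by move=> /maximizersP Hv /maximizersP Hw; apply/eqP; rewrite eq_le Hv Hw. Qed.

Lemma maximizers_trans u v w :
  v \in G u -> dotp u (p v) <= dotp u (p w) -> w \in G u.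
Proof.
by move=> /maximizersP Hv vw; apply/maximizersP => x; exact: le_trans (Hv x) vw.
Qed.

Lemma maximizers_neq0 (v0 : T) u : exists v, v \in G u.
Proof.
exists [arg max_(v > v0) dotp u (p v)]%O; apply/maximizersP => w.
by case: arg_maxP => // i _ /(_ w isT).
Qed.

(** With [e] at most half of every positive gap between two values of [u0], a perturbation of the
    values by less than [e] preserves all strict inequalities, so no new maximizer can appear. *)
Lemma maximizers_usc u0 : exists e, 0 < e /\ forall u,
  (forall v, `|dotp u (p v) - dotp u0 (p v)| < e) -> G u \subset G u0.
Proof.
have [e [e0 He]] : exists e, 0 < e /\ forall vw : T * T,
   dotp u0 (p vw.1) < dotp u0 (p vw.2) ->
   e <= (dotp u0 (p vw.2) - dotp u0 (p vw.1)) / 2.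
  by apply: finite_lower_bound => vw Hvw; lra.
exists e; split=> // u Hu; apply/fintype.subsetP => v /maximizersP vG.
apply/maximizersP => w; rewrite leNgt; apply/negP => vw.
have := He (v, w) vw => /=; have := Hu v; have := Hu w; have := vG w.
rewrite !ltr_norml => ? /andP[? ?] /andP[? ?]; lra.
Qed.

(** Directions are compared through their values on the points only, since these determine the
    maximizers. *)
Definition lipschitz_path (c : R -> 'rV[R]_3) :=
  exists M, forall t t' v, 0 <= t <= 1 -> 0 <= t' <= 1 ->
    `|dotp (c t) (p v) - dotp (c t') (p v)| <= M * `|t - t'|.

Lemma lipschitz_segment u0 u1 :
  lipschitz_path (fun t => (1 - t) *: u0 + t *: u1).
Proof.
have [M [M0 HM]] := finite_upper_bound (fun v => `|dotp (u1 - u0) (p v)|).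
exists M => t t' v _ _; apply: le_trans (_ : `|dotp (u1 - u0) (p v)| * `|t - t'| <= _).
  rewrite -normrM dotpBl !dotpDl !dotpZl le_eqVlt; apply/orP; left; apply/eqP.
  by congr (`| _ |); ring.
by rewrite ler_wpM2r// HM.
Qed.

Lemma sweep_maximizers (T' : Type) (c : R -> 'rV[R]_3)
    (K : 'rV[R]_3 -> T' -> Prop) (E : T' -> T' -> Prop) :
  lipschitz_path c ->
  (forall x y z, E x y -> E y z -> E x z) ->
  (forall u u0 x, G u \subset G u0 -> G (- u) \subset G (- u0) -> K u x -> K u0 x) ->
  (forall t, 0 <= t <= 1 -> exists x, K (c t) x) ->
  (forall t x y, 0 <= t <= 1 -> K (c t) x -> K (c t) y -> E x y) ->
  forall x y, K (c 0) x -> K (c 1) y -> E x y.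
Proof.
move=> [M HM] Etr Kmono Kn KE; apply: (@sweep _ _ (fun t => K (c t))) => // t0 t01.
have [e [e0 He]] := maximizers_usc (c t0).
have [e' [e'0 He']] := maximizers_usc (- c t0).
(* [M] may fail to be positive, while [M'] is a Lipschitz constant by which one can divide. *)
pose M' := 1 + `|M|; have M'0 : 0 < M' by rewrite ltr_pwDl.
exists (Num.min e e' / M'); split; first by rewrite divr_gt0 ?lt_min ?e0.
move=> t tt; rewrite ltr_pdivlMr// lt_min => /andP[te te'] x.
have le v : `|dotp (c t) (p v) - dotp (c t0) (p v)| <= `|t - t0| * M'.
  apply: le_trans (HM _ _ _ tt t01) _; rewrite mulrC ler_wpM2l//.
  by rewrite /M' (le_trans (ler_norm _))// lerDr.
apply: Kmono; [apply: He => v|apply: He' => v].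
  exact: le_lt_trans (le v) te.
rewrite !dotpNl -opprD normrN; exact: le_lt_trans (le v) te'.
Qed.

Hypothesis exposed : forall v, exists a, G a = [set v].

Lemma maximizers_set1 a v w : G a = [set v] -> w != v -> dotp a (p w) < dotp a (p v).
Proof.
move=> Ga wv; have /maximizersP/(_ w) : v \in G a by rewrite Ga set11.
rewrite le_eqVlt => /predU1P[E|//].
suff : w \in G a by rewrite Ga inE (negPf wv).
by apply: maximizers_trans (_ : v \in G a) _; rewrite ?E// Ga set11.
Qed.

Lemma points_inj : injective p.
Proof.
move=> v w E; apply/eqP; apply: contraT => vw; have [a Ga] := exposed w.
by have := maximizers_set1 Ga vw; rewrite E ltxx.
Qed.

Lemma injective_height : exists h, injective (fun v => dotp h (p v)).
Proof.
have [d|h Hh] := @separating_functional R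
    [seq p vw.1 - p vw.2 | vw <- enum [pred vw : T * T | vw.1 != vw.2]].
  case/mapP => -[v w]; rewrite mem_enum /= => vw ->.
  by rewrite subr_eq0 inj_eq//; exact: points_inj.
exists h => v w /eqP E; apply/eqP; apply: contraT => vw.
have : dotp h (p v - p w) != 0.
  by apply: Hh; apply/mapP; exists (v, w) => //; rewrite mem_enum.
by rewrite dotpBr subr_eq0 E.
Qed.

(** Rotate a functional from [a] to [b] and follow its maximizers within the face [G u]. They are
    contained in the face exposed by [u] plus a small multiple of the functional. That face is
    proper, so that [IH] applies, unless the functional is constant on [G u], which is the second
    alternative. *)
Lemma sweep_face (u a b : 'rV[R]_3) (v v' : T) (E : T -> T -> Prop) :
  (forall x y z, E x y -> E y z -> E x z) ->
  v \in G u -> v' \in G u -> G a = [set v] -> G b = [set v'] ->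
  (forall u', G u' \proper G u -> forall x y, x \in G u' -> y \in G u' -> E x y) ->
  E v v' \/ exists2 t, 0 <= t <= 1 & {in G u &, forall x y,
     dotp ((1 - t) *: a + t *: b) (p x) = dotp ((1 - t) *: a + t *: b) (p y)}.
Proof.
move=> Etr vG v'G Ga Gb IH.
pose c t := (1 - t) *: a + t *: b.
pose K (t : R) (x : T) := x \in G u /\ forall y, y \in G u -> dotp (c t) (p y) <= dotp (c t) (p x).
case: (pselect (exists2 t, 0 <= t <= 1 & forall x, x \in G u -> K t x)) => [[t t01 Kt]|nK].
  right; exists t => // x y xG yG; apply/eqP; rewrite eq_le.
  by have [_ Hx] := Kt x xG; have [_ Hy] := Kt y yG; rewrite Hx ?Hy.
left.
have KE t : 0 <= t <= 1 -> exists2 u', G u' \proper G u & forall x, K t x -> x \in G u'.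
  move=> t01; have [e [e0 He]] := maximizers_usc u.
  have [M [M0 HM]] := finite_upper_bound (fun v => `|dotp (c t) (p v)|).
  (* Adding [d *: c t] changes each value by at most [e / 2], within the tolerance of semicontinuity
     at [u]. *)
  pose d := e / 2 / M; have d0 : 0 < d by rewrite !divr_gt0.
  have sub : G (u + d *: c t) \subset G u.
    apply: He => x; rewrite dotpDl addrC addrA addNr add0r dotpZl normrM gtr0_norm//.
    apply: (le_lt_trans (y := d * M)); first by rewrite ler_wpM2l// ltW.
    by rewrite /d divfK ?gt_eqF//; lra.
  have KG x : x \in G u -> (forall y, y \in G u -> dotp (c t) (p y) <= dotp (c t) (p x)) ->
     x \in G (u + d *: c t).
    move=> xG xm; have [z zG] := maximizers_neq0 v (u + d *: c t).
    apply: (maximizers_trans zG); have zGu := fintype.subsetP sub _ zG.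
    rewrite !(dotpDl u) !(dotpZl d) (maximizers_eq zGu xG) lerD2l ler_wpM2l ?xm//.
    exact: ltW.
  exists (u + d *: c t); last by move=> x [] /KG.
  rewrite properE sub /=; apply/negP => sub'; apply: nK; exists t => // x xG; split=> // y yG.
  have := maximizers_eq (fintype.subsetP sub' _ xG) (fintype.subsetP sub' _ yG).
  rewrite !(dotpDl u) !(dotpZl d) (maximizers_eq xG yG).
  by move/addrI/(mulfI (lt0r_neq0 d0)) => ->.
have c0 : c 0 = a by rewrite /c subr0 scale1r scale0r addr0.
have c1 : c 1 = b by rewrite /c subrr scale0r scale1r add0r.
apply: (@sweep R T K E) => //.
- move=> t t01; exists [arg max_(x > v in G u) dotp (c t) (p x)]%O.
  by case: arg_maxP => // x xG Hx; split=> // y /Hx.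
- move=> t x y t01 Kx Ky; have [u' pu H] := KE t t01.
  by apply: (IH u') => //; apply: H.
- move=> t0 t01.
  have [M HM] := lipschitz_segment a b.
  have [e [e0 He]] : exists e, 0 < e /\ forall xy : T * T,
     dotp (c t0) (p xy.1) < dotp (c t0) (p xy.2) ->
     e <= (dotp (c t0) (p xy.2) - dotp (c t0) (p xy.1)) / 2.
    by apply: finite_lower_bound => xy ?; lra.
  pose M' := 1 + `|M|; have M'0 : 0 < M' by rewrite ltr_pwDl.
  exists (e / M'); split; first by rewrite divr_gt0.
  move=> t tt; rewrite ltr_pdivlMr// => te x [xG Hx]; split=> // y yG.
  have le z : `|dotp (c t) (p z) - dotp (c t0) (p z)| < e.
    apply: le_lt_trans (HM _ _ _ tt t01) _; apply: le_lt_trans te; rewrite mulrC ler_wpM2l//.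
    by rewrite /M' (le_trans (ler_norm _))// lerDr.
  rewrite leNgt; apply/negP => xy; have := He (x, y) xy => /=.
  have := le x; have := le y; have := Hx y yG.
  rewrite !ltr_norml => ? /andP[? ?] /andP[? ?]; lra.
- by split=> // y yG; rewrite c0; have /maximizersP : v \in G a by rewrite Ga set11.
- by split=> // y yG; rewrite c1; have /maximizersP : v' \in G b by rewrite Gb set11.
Qed.

(* Along [v, v'] the functionals exposing [v] and [v'] are opposite, so every
   third point of the face lies strictly between [v] and [v'] for both. *)
Lemma constant_combination_between (a b : 'rV[R]_3) (v v' w : T) (t : R) :
  G a = [set v] -> G b = [set v'] -> v != v' -> w != v -> w != v' -> 0 <= t <= 1 ->
  (forall x, x \in [:: v'; w] ->
     dotp ((1 - t) *: a + t *: b) (p v) = dotp ((1 - t) *: a + t *: b) (p x)) ->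
  dotp a (p v') < dotp a (p w) /\ dotp b (p v) < dotp b (p w).
Proof.
move=> Ga Gb vv' wv wv' /andP[t0 t1] H.
have := H v'; have := H w; rewrite !inE !eqxx orbT => /(_ isT) Hw /(_ isT) Hv'.
have av' : dotp a (p v') < dotp a (p v) by apply: maximizers_set1 Ga _; rewrite eq_sym.
have aw := maximizers_set1 Ga wv.
have bv := maximizers_set1 Gb vv'; have bw := maximizers_set1 Gb wv'.
move: Hw Hv'; rewrite !dotpDl !dotpZl.
case: (eqVneq t 0) => [->|tn0]; first by lra.
case: (eqVneq t 1) => [->|tn1]; first by lra.
have {tn0}t0 : 0 < t by rewrite lt_def tn0.
have {tn1}t1 : 0 < 1 - t by rewrite subr_gt0 lt_def eq_sym tn1.
move=> Hw Hv'; split.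
  rewrite -subr_gt0 -(pmulr_rgt0 _ t1).
  have : 0 < t * (dotp b (p v') - dotp b (p w)) by rewrite mulr_gt0// subr_gt0.
  lra.
rewrite -subr_gt0 -(pmulr_rgt0 _ t0).
have : 0 < (1 - t) * (dotp a (p v) - dotp a (p w)) by rewrite mulr_gt0// subr_gt0.
lra.
Qed.

(* If the sweep from [v] to [v'] fails and the face has a third point [w], then
   the sweeps from [v] to [w] and from [w] to [v'] both succeed. *)
Lemma face_connected (E : T -> T -> Prop) (u : 'rV[R]_3) :
  (forall x, E x x) -> (forall x y z, E x y -> E y z -> E x z) ->
  (forall a v v', v != v' -> G a = [set v; v'] -> G a \subset G u -> E v v') ->
  {in G u &, forall v v', E v v'}.
Proof.
move=> E0 Etr; have [n] := ubnP #|G u|; elim: n => // n IH in u * => Gn Eu.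
have {}IH u' : G u' \proper G u -> forall x y, x \in G u' -> y \in G u' -> E x y.
  move=> pu x y; apply: (IH u') => [|a v v' vv' Ga sub].
    by have := proper_card pu; lia.
  by apply: (Eu a) => //; exact: fintype.subset_trans (proper_sub pu).
move=> v v' vG v'G; case: (eqVneq v v') => [->//|vv'].
have [a Ga] := exposed v; have [b Gb] := exposed v'.
case: (sweep_face Etr vG v'G Ga Gb IH) => // -[t t01 Ht].
case: (eqVneq (G u) [set v; v']) => [Gu|Gu]; first exact: (Eu u).
have [w wG /andP[wv wv']] : exists2 w, w \in G u & (w != v) && (w != v').
  apply: contrapT => H; case/eqP: Gu; apply/eqP; rewrite finset.eqEsubset; apply/andP; split.
    apply/fintype.subsetP => w wG; rewrite finset.in_set2; apply: contraT => /norP[wv wv'].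
    by case: H; exists w => //; rewrite wv.
  by apply/fintype.subsetP => w; rewrite finset.in_set2 => /orP[] /eqP ->.
have vw : v != w by rewrite eq_sym.
have v'w : v' != w by rewrite eq_sym.
have v'v : v' != v by rewrite eq_sym.
have [d Gd] := exposed w.
have [|av'w bvw] := @constant_combination_between a b v v' w t Ga Gb vv' wv wv' t01.
  by move=> x; rewrite !inE => /orP[] /eqP ->; apply: Ht.
apply: (Etr _ w).
  (* If this sweep failed, [w] would be lower than [v'] for [a], against [av'w]; the other half
     contradicts [bvw] in the same way. *)
  case: (sweep_face Etr vG wG Ga Gd IH) => // -[t' t'01 Ht'].
  have [] := @constant_combination_between a d v w v' t' Ga Gd vw v'v v'w t'01.
    by move=> x; rewrite !inE => /orP[] /eqP ->; apply: Ht'.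
  by rewrite ltNge (ltW av'w).
case: (sweep_face Etr wG v'G Gd Gb IH) => // -[t' t'01 Ht'].
have [] := @constant_combination_between d b w v' v t' Gd Gb wv' vw vv' t'01.
  by move=> x; rewrite !inE => /orP[] /eqP ->; apply: Ht'.
by move=> _; rewrite ltNge (ltW bvw).
Qed.

End Maximizers.

(** * Potentials on the set of antipodal pairs *)

Section Potentials.
Variables (R : realType) (T : finType) (p : T -> 'rV[R]_3).
Local Notation G := (maximizers p).
Hypothesis exposed : forall v, exists a, G a = [set v].
Hypothesis full_dim : forall u, (forall v w, dotp u (p v) = dotp u (p w)) -> u = 0.

(** If the combination vanished, [v] would minimize [u0] as well as maximize it. Then [u0] would be
    constant on the points, hence 0 by full dimension. *)
Lemma segment_neq0 u0 u1 v t :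
  u0 != 0 -> u1 != 0 -> v \in G u0 -> v \in G u1 -> 0 <= t <= 1 ->
  (1 - t) *: u0 + t *: u1 != 0.
Proof.
move=> u0n u1n /maximizersP v0 /maximizersP v1 /andP[t0 t1]; apply/eqP => E.
case: (eqVneq t 1) => [t1E|tn1].
  by move: E; rewrite t1E subrr scale0r scale1r add0r => /eqP; rewrite (negPf u1n).
have {}t1 : 0 < 1 - t by rewrite subr_gt0 lt_def eq_sym tn1.
suff H w : dotp u0 (p w) = dotp u0 (p v).
  by case/eqP: u0n; apply: full_dim => x y; rewrite !H.
apply/eqP; rewrite eq_le v0 /= -subr_ge0 -(pmulr_rge0 _ t1).
have Ev : dotp ((1 - t) *: u0 + t *: u1) (p v) = 0 by rewrite E dotp0l.
have Ew : dotp ((1 - t) *: u0 + t *: u1) (p w) = 0 by rewrite E dotp0l.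
move: Ev Ew; rewrite !dotpDl !dotpZl => Ev Ew.
have := mulr_ge0 t0 (_ : 0 <= dotp u1 (p v) - dotp u1 (p w)).
by rewrite subr_ge0 => /(_ (v1 w)); lra.
Qed.

(* A segment between directions may pass through [0]; the detour through a
   direction [z] orthogonal to both ends does not. *)
Lemma sphere_sweep (T' : Type) (K : 'rV[R]_3 -> T' -> Prop) (E : T' -> T' -> Prop) :
  (forall x y z, E x y -> E y z -> E x z) ->
  (forall u u0 x, G u \subset G u0 -> G (- u) \subset G (- u0) -> K u x -> K u0 x) ->
  (forall u, u != 0 -> exists x, K u x) ->
  (forall u x y, u != 0 -> K u x -> K u y -> E x y) ->
  forall u u' x y, u != 0 -> u' != 0 -> K u x -> K u' y -> E x y.
Proof.
move=> Etr Kmono Kn KE.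
have seg u u' x y : (forall t, 0 <= t <= 1 -> (1 - t) *: u + t *: u' != 0) ->
    K u x -> K u' y -> E x y.
  move=> H Kx Ky.
  apply: (sweep_maximizers (lipschitz_segment p u u') Etr Kmono) => [t /H /Kn //| | |].
  - by move=> t a b /H; exact: KE.
  - by rewrite subr0 scale1r scale0r addr0.
  - by rewrite subrr scale0r scale1r add0r.
move=> u u' x y u0 u'0 Kx Ky.
have [z [z0 zu zu']] := orthogonal_exists u u'.
have [w Kw] := Kn z z0.
have zz := dotp_gt0 z0; have uu := dotp_gt0 u0; have uu' := dotp_gt0 u'0.
have nz a t : dotp z a = 0 -> a != 0 -> (1 - t) *: z + t *: a != 0.
  move=> za a0; apply/eqP => H.
  have : dotp z ((1 - t) *: z + t *: a) = 0 by rewrite H dotpC dotp0l.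
  rewrite dotpDr !dotpZr za mulr0 addr0 => /eqP; rewrite mulf_eq0 (gt_eqF zz) orbF subr_eq0.
  move=> /eqP t1; move: H; rewrite -t1 subrr scale0r scale1r add0r => /eqP.
  by rewrite (negPf a0).
apply: (Etr _ w).
  apply: (seg u z) => // t _; have := nz u (1 - t) zu u0.
  by rewrite subKr addrC.
by apply: (seg z u') => // t _; exact: nz.
Qed.

(** * Extending a potential over the points by increasing height *)

Section Rectangles.
Variables (A : zmodType) (phi : T -> T -> A).
Hypothesis rectangle : forall u v v' w w', u != 0 ->
  v \in G u -> v' \in G u -> w \in G (- u) -> w' \in G (- u) ->
  phi v w - phi v' w = phi v w' - phi v' w'.

(** By [rectangle] the right-hand side is independent of [y]. *)
Definition potential_on (L : pred T) (alpha : T -> A) :=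
  forall u v v' y, u != 0 -> v \in G u -> v' \in G u -> y \in G (- u) ->
    L v -> L v' -> alpha v - alpha v' = phi v y - phi v' y.

Section Extension.
Variables (v : T) (h : 'rV[R]_3) (alpha : T -> A).
Let L := [pred w | dotp h (p w) < dotp h (p v)].
Hypothesis alphaP : potential_on L alpha.

(** The value that a lower point [w] sharing the face [G u] with [v] forces on any extension of
    [alpha] to [v]. *)
Definition extension_value u k := exists w y,
  [/\ L w, w \in G u, v \in G u, y \in G (- u) & k = alpha w + phi v y - phi w y].

Lemma extension_value_uniq u k k' :
  u != 0 -> extension_value u k -> extension_value u k' -> k = k'.
Proof.
move=> u0 [w [y [Lw wG vG yG ->]]] [w' [y' [Lw' w'G _ y'G ->]]].
have E1 := alphaP u0 wG w'G y'G Lw Lw'.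
have E2 := rectangle u0 vG wG yG y'G.
rewrite -addrA E2 (canRL (subrK _) E1) [_ + alpha w']addrC -[LHS]addrA -[RHS]addrA; congr (_ + _).
by rewrite addrC subrKA.
Qed.

(* [u_t = (1 - t) u1 + t u2] is pushed along [-h] until a lower point becomes a
   maximizer together with [v]. *)
Lemma extension_value_path u1 u2 k1 k2 :
  (forall t s, 0 <= t <= 1 -> 0 <= s -> (1 - t) *: u1 + t *: u2 != s *: h) ->
  extension_value u1 k1 -> extension_value u2 k2 -> k1 = k2.
Proof.
move=> nray K1 K2.
have [w1 [_ [Lw1 w1G v1G _ _]]] := K1; have [w2 [_ [Lw2 w2G v2G _ _]]] := K2.
have [c [cE c_lip c0 c1]] : exists c, [/\ forall t, c t = (1 - t) *: u1 + t *: u2,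
    lipschitz_path p c, c 0 = u1 & c 1 = u2].
  exists (fun t => (1 - t) *: u1 + t *: u2); split=> //; first exact: lipschitz_segment.
    by rewrite subr0 scale1r scale0r addr0.
  by rewrite subrr scale0r scale1r add0r.
have vc t x : 0 <= t <= 1 -> dotp (c t) (p x) <= dotp (c t) (p v).
  move=> /andP[t0 t1]; rewrite cE !dotpDl !dotpZl lerD// ler_wpM2l ?subr_ge0//.
    exact: (maximizersP _ _ _ v1G).
  exact: (maximizersP _ _ _ v2G).
have Lpos x : L x -> 0 < dotp h (p v) - dotp h (p x) by rewrite /= subr_gt0.
(* [f t x] is the multiple of [h] to subtract from [c t] for the lower point [x] to tie with [v].
   The first tie happens at the minimum [s t], with the point [m t]. *)
have [f fE] : exists f, forall t x, f t x =
    (dotp (c t) (p v) - dotp (c t) (p x)) / (dotp h (p v) - dotp h (p x)).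
  by eexists => t x; reflexivity.
have [m [Lm mP]] : exists m : R -> T, (forall t, L (m t)) /\
    forall t x, L x -> f t (m t) <= f t x.
  exists (fun t => [arg min_(x < w1 | L x) f t x]%O).
  by split=> t; case: arg_minP.
have [s sE] : exists s, forall t, s t = f t (m t) by exists (fun t => f t (m t)).
have sP t x : L x -> s t * (dotp h (p v) - dotp h (p x)) <= dotp (c t) (p v) - dotp (c t) (p x).
  by move=> Lx; rewrite -ler_pdivlMr ?Lpos// -fE sE mP.
have sm t : s t * (dotp h (p v) - dotp h (p (m t))) = dotp (c t) (p v) - dotp (c t) (p (m t)).
  by rewrite sE fE divfK ?gt_eqF ?Lpos.
have s0 t : 0 <= t <= 1 -> 0 <= s t.
  by move=> tt; rewrite sE fE divr_ge0 ?subr_ge0 ?vc// ltW// -subr_gt0 Lpos.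
have [d dE] : exists d, forall t, d t = c t - s t *: h by eexists => t; reflexivity.
have dotd t x : dotp (d t) (p x) = dotp (c t) (p x) - s t * dotp h (p x).
  by rewrite dE dotpBl dotpZl.
have dn0 t : 0 <= t <= 1 -> d t != 0.
  by move=> tt; rewrite dE subr_eq0 cE; apply: nray => //; exact: s0.
(* Lower points stay below or tie with [v] because [s t] is minimal; for the others, subtracting a
   nonnegative multiple of [h] only helps [v]. *)
have vd t : 0 <= t <= 1 -> v \in G (d t).
  move=> tt; apply/maximizersP => x; rewrite !dotd.
  case: (boolP (L x)) => [Lx|]; first by have := sP t x Lx; lra.
  rewrite /= -leNgt => hx; have := ler_wpM2l (s0 t tt) hx; have := vc t x tt; lra.
have md t : 0 <= t <= 1 -> m t \in G (d t).
  by move=> tt; apply: (maximizers_trans (vd t tt)); rewrite !dotd; have := sm t; lra.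
(* A minimum of finitely many functions with a common Lipschitz constant has that constant too; the
   one-sided bound suffices, as [t] and [t'] can be exchanged. *)
have [M [M0 HM]] : exists M, 0 <= M /\ forall t t', 0 <= t <= 1 -> 0 <= t' <= 1 ->
    s t - s t' <= M * `|t - t'|.
  have [M HM] := c_lip.
  have [N [N0 HN]] := finite_upper_bound (fun x => (dotp h (p v) - dotp h (p x))^-1).
  exists ((M + M) * N); split.
    have := HM 0 1 v; rewrite !lexx !ler01 sub0r normrN1 mulr1 => /(_ isT isT) M0.
    have {}M0 := le_trans (normr_ge0 _) M0.
    by rewrite mulr_ge0 ?addr_ge0// ltW.
  move=> t t' tt tt'.
  apply: le_trans (_ : f t (m t') - f t' (m t') <= _); first by rewrite !sE lerD2r mP.
  rewrite !fE -mulrBl [leRHS]mulrAC.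
  have i0 : 0 <= (dotp h (p v) - dotp h (p (m t')))^-1 by rewrite invr_ge0 ltW ?Lpos.
  have H1 := HM t t' v tt tt'; have H2 := HM t t' (m t') tt tt'.
  apply: le_trans (_ : ((M + M) * `|t - t'|) * (dotp h (p v) - dotp h (p (m t')))^-1 <= _).
    apply: ler_wpM2r => //; move: H1 H2.
    move: (dotp (c t) _) (dotp (c t) _) (dotp (c t') _) (dotp (c t') _) `|t - t'| => x y z w e.
    by rewrite !ler_norml mulrDl => /andP[? ?] /andP[? ?]; lra.
  apply: ler_wpM2l => //.
  by rewrite mulrDl addr_ge0// (le_trans (normr_ge0 _) H1).
have d_lip : lipschitz_path p d.
  have [N HN] := c_lip.
  have [C [C0 HC]] := finite_upper_bound (fun x => `|dotp h (p x)|).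
  exists (N + M * C) => t t' x tt tt'.
  have -> : dotp (d t) (p x) - dotp (d t') (p x) =
      (dotp (c t) (p x) - dotp (c t') (p x)) - (s t - s t') * dotp h (p x).
    by rewrite !dotd; ring.
  apply: (le_trans (ler_normB _ _)); rewrite (mulrDl N) lerD//; first exact: HN.
  rewrite normrM mulrAC ler_pM//.
  rewrite ler_norml HM// andbT -lerN2 opprK opprB distrC; exact: HM.
(* At both ends a lower point is already a maximizer together with [v], so nothing is subtracted. *)
have d0 : d 0 = u1.
  have : s 0 = 0.
    apply/eqP; rewrite eq_le s0 ?lexx ?ler01// andbT.
    by have := mP 0 w1 Lw1; rewrite -sE fE c0 (maximizers_eq v1G w1G) subrr mul0r.
  by rewrite dE c0 => ->; rewrite scale0r subr0.
have d1 : d 1 = u2.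
  have : s 1 = 0.
    apply/eqP; rewrite eq_le s0 ?lexx ?ler01// andbT.
    by have := mP 1 w2 Lw2; rewrite -sE fE c1 (maximizers_eq v2G w2G) subrr mul0r.
  by rewrite dE c1 => ->; rewrite scale0r subr0.
rewrite -d0 in K1; rewrite -d1 in K2.
apply: (sweep_maximizers d_lip _ _ _ _ K1 K2).
- by move=> x y z -> ->.
- move=> u u0 k /fintype.subsetP Gu /fintype.subsetP GNu [w [y [Lw wG vG yG ->]]].
  by exists w, y; split; [|exact: Gu|exact: Gu|exact: GNu|].
- move=> t tt; have [y yG] := maximizers_neq0 p v (- d t).
  exists (alpha (m t) + phi v y - phi (m t) y), (m t), y.
  by split=> //; [exact: md|exact: vd].
- by move=> t x y tt; apply: extension_value_uniq; exact: dn0.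
Qed.

End Extension.

(* When [v] is the highest point, a segment from [u1] to [u2] may meet the ray of
   [h]; then [h] is first tilted towards a [z] orthogonal to [u1] and [u2]. *)
Lemma extension_value_const v h alpha u1 u2 k1 k2 :
  injective (fun x => dotp h (p x)) ->
  potential_on [pred w | dotp h (p w) < dotp h (p v)] alpha ->
  u1 != 0 -> u2 != 0 ->
  extension_value v h alpha u1 k1 -> extension_value v h alpha u2 k2 -> k1 = k2.
Proof.
move=> h_inj alphaP u1n u2n K1 K2.
have [_ [_ [_ _ v1G _ _]]] := K1; have [_ [_ [_ _ v2G _ _]]] := K2.
have cn0 t : 0 <= t <= 1 -> (1 - t) *: u1 + t *: u2 != 0 by exact: segment_neq0 v1G v2G.
(* If some [x] is higher than [v], the segment misses the ray: [v] maximizes every direction of the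
   segment, whereas a positive multiple of [h] prefers [x]. *)
case: (boolP [exists x, dotp h (p v) < dotp h (p x)]) => [/existsP[x hx]|].
  apply: (extension_value_path alphaP _ K1 K2) => t s tt s0.
  case: (eqVneq s 0) => [->|sn0]; first by rewrite scale0r cn0.
  apply/eqP => /(congr1 (fun u => dotp u (p x) - dotp u (p v))).
  move/maximizersP: v1G => /(_ x); move/maximizersP: v2G => /(_ x).
  rewrite !dotpDl !dotpZl => H2 H1; case/andP: tt => t0 t1 E.
  have {}s0 : 0 < s by rewrite lt_def sn0.
  have : 0 < s * (dotp h (p x) - dotp h (p v)) by rewrite mulr_gt0// subr_gt0.
  have : (1 - t) * dotp u1 (p x) <= (1 - t) * dotp u1 (p v) by rewrite ler_wpM2l// subr_ge0.
  have : t * dotp u2 (p x) <= t * dotp u2 (p v) by rewrite ler_wpM2l.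
  lra.
move=> /existsPn hmax.
have Gh : G h = [set v]%SET.
  apply/setP => x; rewrite finset.in_set1; apply/idP/eqP => [xG|->].
    apply: h_inj; apply/eqP; rewrite eq_le; move/maximizersP: xG => /(_ v) ->.
    by rewrite leNgt hmax.
  by apply/maximizersP => w; rewrite leNgt hmax.
(* The sign of [z] is chosen so that the tilted [h'] pairs positively with [z], while the whole
   segment pairs to 0; hence the segment misses the ray of [h'] except possibly at 0. *)
have [z [z0 zu1 zu2 hz]] : exists z, [/\ z != 0, dotp z u1 = 0, dotp z u2 = 0 & 0 <= dotp z h].
  have [z [z0 zu1 zu2]] := orthogonal_exists u1 u2.
  case: (leP 0 (dotp z h)) => hz; first by exists z.
  by exists (- z); rewrite oppr_eq0 !dotpNl zu1 zu2 oppr0 oppr_ge0 ltW.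
have [e [e0 He]] := maximizers_usc p h.
have [M [M0 HM]] := finite_upper_bound (fun x => `|dotp z (p x)|).
pose h' := h + (e / 2 / M) *: z.
have em : 0 < e / 2 / M by rewrite !divr_gt0.
have Gh' : G h' = [set v]%SET.
  have [x xG] := maximizers_neq0 p v h'.
  have sub : G h' \subset G h.
    apply: He => w; rewrite dotpDl addrC addrA addNr add0r dotpZl normrM gtr0_norm//.
    apply: (@le_lt_trans _ _ (e / 2 / M * M)); first by rewrite ler_wpM2l// ltW.
    by rewrite divfK ?gt_eqF//; lra.
  apply/eqP; rewrite finset.eqEsubset -{1}Gh sub finset.sub1set.
  by have := fintype.subsetP sub _ xG; rewrite Gh finset.in_set1 => /eqP <-.
(* Both [h] and [h'] are maximized at [v] alone, so the set of lower points does not change. *)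
have LE w : (dotp h (p w) < dotp h (p v)) = (dotp h' (p w) < dotp h' (p v)).
  case: (eqVneq w v) => [->|wv]; first by rewrite !ltxx.
  by rewrite (maximizers_set1 Gh)// (maximizers_set1 Gh').
apply: (@extension_value_path v h' alpha _ u1 u2).
- by move=> u w w' y u0 wG w'G yG Lw Lw'; apply: (alphaP u) => //=; rewrite LE.
- move=> t s tt s0; case: (eqVneq s 0) => [->|sn0]; first by rewrite scale0r cn0.
  apply/eqP => /(congr1 (dotp z)); rewrite dotpDr !dotpZr zu1 zu2 !mulr0 addr0 => /esym/eqP.
  rewrite mulf_eq0 (negPf sn0) /= dotpDr dotpZr gt_eqF//.
  by rewrite ltr_wpDl// mulr_gt0// dotp_gt0.
- by case: K1 => w [y [Lw ? ? ? ?]]; exists w, y; split=> //=; rewrite -LE.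
- by case: K2 => w [y [Lw ? ? ? ?]]; exists w, y; split=> //=; rewrite -LE.
Qed.

(* The potential is extended to one point at a time, by increasing height. *)
Lemma potential_exists : exists alpha, potential_on predT alpha.
Proof.
have [h h_inj] := injective_height exposed.
suff H n : forall c, (#|[pred v | (dotp h (p v) < c)%R]| <= n)%N ->
    exists alpha, potential_on [pred v | dotp h (p v) < c] alpha.
  have [M [_ HM]] := finite_upper_bound (fun v => dotp h (p v)).
  have [alpha Ha] := H _ (M + 1) (leqnn _); exists alpha => u v v' y u0 vG v'G yG _ _.
  by apply: (Ha u) => //=; apply: (le_lt_trans (HM _)); rewrite ltrDl.
elim: n => [|n IH] c.
  rewrite leqn0 => /eqP/card0_eq L0; exists (fun _ => 0) => u v v' y _ _ _ _ Lv _.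
  by move: Lv => /=; have := L0 v; rewrite inE /= => ->.
move=> Ln; case: (pickP [pred v | dotp h (p v) < c]) => [v0 Lv0|L0]; last first.
  by exists (fun _ => 0) => u v v' y _ _ _ _ Lv _; move: Lv => /=; have := L0 v => /= ->.
pose v := [arg max_(v > v0 | dotp h (p v) < c) dotp h (p v)]%O.
have [vc vm] : dotp h (p v) < c /\ forall w, dotp h (p w) < c -> dotp h (p w) <= dotp h (p v).
  by rewrite /v; case: arg_maxP.
have LE w : (dotp h (p w) < c) = (w == v) || (dotp h (p w) < dotp h (p v)).
  apply/idP/orP => [/vm|[/eqP ->//|/lt_trans]]; last by apply.
  by rewrite le_eqVlt => /orP[/eqP /h_inj ->|]; [left|right].
have [|alpha Ha] := IH (dotp h (p v)).
  rewrite -ltnS; apply: leq_trans Ln; apply: proper_card; apply/properP; split.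
    by apply/fintype.subsetP => w; rewrite !inE LE => ->; rewrite orbT.
  by exists v; rewrite !inE ?ltxx.
(* [k] is the common extension value at [v]; if no nonzero direction yields one, the condition is
   empty and 0 is taken. *)
have [k Hk] : exists k, forall u k', u != 0 -> extension_value v h alpha u k' -> k' = k.
  case: (pselect (exists u k', u != 0 /\ extension_value v h alpha u k')).
    move=> [u [k [u0 Hk]]]; exists k => u' k' u'0 Hk'.
    exact: extension_value_const h_inj Ha u'0 u0 Hk' Hk.
  by move=> H; exists 0 => u k' u0 Hk; case: H; exists u, k'.
exists (fun w => if w == v then k else alpha w) => u w w' y u0 wG w'G yG /=.
have val x : x \in G u -> v \in G u -> dotp h (p x) < dotp h (p v) ->
    k - alpha x = phi v y - phi x y.
  move=> xG vG hx; have <- := Hk u (alpha x + phi v y - phi x y) u0.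
    by rewrite addrC !addrA addNr add0r.
  by exists x, y; split.
rewrite !LE; move: wG w'G.
case: (eqVneq w v) => [->|wv] /=; case: (eqVneq w' v) => [->|w'v] /=.
- by rewrite !subrr.
- by move=> vG w'G _ hw'; apply: val.
- by move=> wG vG hw _; rewrite -opprB val// opprB.
- by move=> wG w'G hw hw'; apply: (Ha u).
Qed.

End Rectangles.
End Potentials.

(** * Antisymmetric cocycles on opposite pairs *)

Section Cocycles.
Variables (R : realType) (T : finType) (p : T -> 'rV[R]_3).
Local Notation G := (maximizers p).
Hypothesis exposed : forall v, exists a, G a = [set v].
Hypothesis full_dim : forall u, (forall v w, dotp u (p v) = dotp u (p w)) -> u = 0.

Definition opposite v w := exists2 u, u != 0 & v \in G u /\ w \in G (- u).

Lemma opposite_sym v w : opposite v w -> opposite w v.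
Proof. by move=> [u u0 [vG wG]]; exists (- u); rewrite ?oppr_eq0 ?opprK. Qed.

(** A point maximizing both [u] and [- u] would keep the segment between them away from 0, but the
    midpoint of that segment is 0. *)
Lemma opposite_neq v w : opposite v w -> v != w.
Proof.
move=> [u u0 [vG wG]]; apply: contraTneq vG => vw; apply/negP => vG; subst w.
have uN0 : - u != 0 by rewrite oppr_eq0.
have := @segment_neq0 R T p full_dim u (- u) v 2^-1 u0 uN0 vG wG.
rewrite scalerN -scalerBl (_ : 1 - _ - _ = 0); last by lra.
by rewrite scale0r eqxx invr_ge0 invf_le1 ?ler1n//= ler0n => /(_ isT).
Qed.

Lemma maximizers_cover v : exists2 u, u != 0 & v \in G u.
Proof.
(* If 0 exposes [v], then [v] is the only point, and it maximizes any direction. *)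
have [a Ga] := exposed v; case: (eqVneq a 0) => [a0|a0]; last first.
  by exists a; rewrite ?Ga ?finset.set11.
have u0 : const_mx 1 != 0 :> 'rV[R]_3.
  by apply/eqP => /rowP/(_ 0); rewrite !mxE => /eqP; rewrite oner_eq0.
have [x xG] := maximizers_neq0 p v (const_mx 1).
exists (const_mx 1) => //; suff <- : x = v by [].
apply/eqP; rewrite -finset.in_set1 -Ga a0.
by apply/maximizersP => w; rewrite !dotp0l.
Qed.

Lemma opposite_exists v : exists w, opposite v w.
Proof.
have [u u0 vG] := maximizers_cover v; have [w wG] := maximizers_neq0 p v (- u).
by exists w, u.
Qed.

(** Two maximizers of [u] have a common opposite, any maximizer of [- u]; a sweep over the sphere of
    directions then joins arbitrary points. *)
Lemma opposite_connected (E : T -> T -> Prop) :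
  (forall x y z, E x y -> E y z -> E x z) ->
  (forall v v' w, opposite v w -> opposite v' w -> E v v') ->
  forall v v', E v v'.
Proof.
move=> Etr EO v v'.
have [u u0 vG] := maximizers_cover v; have [u' u'0 v'G] := maximizers_cover v'.
apply: (@sphere_sweep R T p T (fun u x => x \in G u) E Etr _ _ _ u u') => //.
- by move=> w w' x /fintype.subsetP Gw _ /Gw.
- by move=> w _; exact: maximizers_neq0 v w.
- move=> w x y w0 xG yG; have [z zG] := maximizers_neq0 p v (- w).
  by apply: (EO _ _ z); exists w.
Qed.

Variables (A : zmodType) (phi : T -> T -> A).

Hypothesis square : forall u a b v v' w w', u != 0 -> v != v' -> w != w' ->
  G a = [set v; v'] -> G b = [set w; w'] -> G a \subset G u -> G b \subset G (- u) ->
  phi v w - phi v' w = phi v w' - phi v' w'.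

(** Faces are connected through their edges, so the relation for pairs of edges propagates, first
    along [G u] for a fixed edge of [G (- u)], then along [G (- u)]. *)
Lemma rectangle u v v' w w' : u != 0 ->
  v \in G u -> v' \in G u -> w \in G (- u) -> w' \in G (- u) ->
  phi v w - phi v' w = phi v w' - phi v' w'.
Proof.
move=> u0 vG v'G wG w'G.
have H (x y : T) : x != y -> (exists2 a, G a = [set x; y]%SET & G a \subset G (- u)) ->
    phi v x - phi v' x = phi v y - phi v' y.
  move=> xy [b Gb sub].
  pose E v v' := phi v x - phi v' x = phi v y - phi v' y.
  apply: (@face_connected R T p exposed E u) => //.
  - by move=> z; rewrite /E !subrr.
  - rewrite /E => z1 z2 z3 E1 E2.
    by rewrite -[LHS](subrKA (phi z2 x)) -[RHS](subrKA (phi z2 y)) E1 E2.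
  - by move=> a z z' zz' Ga sub'; exact: (square u0 zz' xy Ga Gb sub' sub).
apply: (@face_connected R T p exposed (fun x y =>
   phi v x - phi v' x = phi v y - phi v' y) (- u)) => //.
- by move=> x y z -> ->.
- by move=> a x y xy Ga sub; apply: H => //; exists a.
Qed.

Hypothesis antisym : forall v w, opposite v w -> phi w v = - phi v w.

Theorem antisymmetric_cocycle : exists alpha c, c + c = 0 /\
  forall v w, opposite v w -> phi v w = alpha v - alpha w + c.
Proof.
have [[v0]|T0] := pselect (inhabited T); last first.
  by exists (fun _ => 0), 0; split=> [|v]; [exact: addr0|case: T0].
have [alpha Ha] := potential_exists exposed full_dim rectangle.
have [beta Hb] : exists beta, potential_on p (fun w v => phi v w) predT beta.
  apply: (potential_exists exposed full_dim) => u v v' w w' u0 vG v'G wG w'G.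
  have uN0 : - u != 0 by rewrite oppr_eq0.
  have := rectangle uN0 wG w'G; rewrite opprK => /(_ _ _ vG v'G) E.
  by rewrite (canRL (subrK _) E) addrC !addrA addNr add0r addrC.
pose psi v w := phi v w - alpha v - beta w.
(* [psi] is constant on each product of [G u] and [G (- u)], and the sweep over the sphere makes
   these constants agree. *)
have [k Hk] : exists k, forall v w, opposite v w -> psi v w = k.
  have [w0 v0w0] := opposite_exists v0.
  exists (psi v0 w0) => v w [u u0 [vG wG]]; case: v0w0 => u' u'0 [v0G w0G].
  apply: (@sphere_sweep R T p A
    (fun u k => exists v w, [/\ v \in G u, w \in G (- u) & k = psi v w])
     eq _ _ _ _ u u') => //.
  - by move=> ? ? ? -> ->.
  - move=> x y z /fintype.subsetP sub /fintype.subsetP subN [s [t [sG tG ->]]].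
    by exists s, t; split; [exact: sub|exact: subN|].
  - move=> x x0; have [s sG] := maximizers_neq0 p v0 x.
    by have [t tG] := maximizers_neq0 p v0 (- x); exists (psi s t), s, t.
  - move=> x _ _ x0 [s [t [sG tG ->]]] [s' [t' [s'G t'G ->]]].
    have xN0 : - x != 0 by rewrite oppr_eq0.
    have E1 := Ha x s s' t x0 sG s'G tG isT isT.
    have := Hb (- x) t t' s' xN0 tG t'G; rewrite opprK => /(_ s'G isT isT) E2.
    have E : phi s t = alpha s - alpha s' + (beta t - beta t') + phi s' t'.
      by rewrite E1 E2 subrKA subrK.
    rewrite /psi E addrACA -opprD -[LHS]addrA -opprD [LHS]addrAC [X in X + _ = _]addrAC.
    by rewrite subrr add0r addrC opprD addrA.
  - by exists v, w.
  - by exists v0, w0.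
have phiE v w : opposite v w -> phi v w = alpha v + beta w + k.
  by move=> /Hk <-; rewrite /psi; rewrite [RHS]addrC -[phi v w - _ - _]addrA -opprD subrK.
(* Antisymmetry makes [gamma] change sign between opposite points. It therefore agrees on points
   with a common opposite, is a constant [c], and satisfies [c = - c]. *)
pose gamma v := alpha v + beta v + k.
have gammaN v w : opposite v w -> gamma w = - gamma v.
  move=> vw; apply/eqP; rewrite -addr_eq0 /gamma; apply/eqP.
  have := antisym vw; rewrite (phiE _ _ vw) (phiE _ _ (opposite_sym vw)) => /eqP.
  rewrite -addr_eq0 => /eqP <-.
  rewrite [LHS]addrACA [RHS]addrACA; congr (_ + _).
  by rewrite [LHS]addrACA [RHS]addrACA [beta w + _]addrC.
pose c := gamma v0.
have gammaE v : gamma v = c.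
  apply: (@opposite_connected (fun v w => gamma v = gamma w)) => [? ? ? -> ->//|x x' y].
  by move=> /opposite_sym/gammaN -> /opposite_sym/gammaN ->.
have cc : c + c = 0.
  have [w /gammaN] := opposite_exists v0; rewrite !gammaE => {1}->; exact: addNr.
exists alpha, c; split=> // v w /phiE ->; rewrite -(gammaE w) /gamma.
by rewrite -!addrA addKr.
Qed.

End Cocycles.

(** * Homology of complexes with the cocycles of the projective plane *)

Local Open Scope quotient_scope.
Local Open Scope ring_scope.

Section Cokernel.
Variables (U V : zmodType) (f : {additive U -> V}).

Definition image_pred : {pred V} := [pred v | `[< exists u, v = f u >]].

Lemma image_closed : zmod_closed image_pred.
Proof.
split=> [|x y]; first by apply/asboolP; exists 0; rewrite raddf0.
by move=> /asboolP[u ->] /asboolP[w ->]; apply/asboolP; exists (u - w); rewrite raddfB.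
Qed.

HB.instance Definition _ := GRing.isZmodClosed.Build V image_pred image_closed.

(** Taking cocycles with values in chains modulo boundaries turns the description of all cocycles
    into a criterion for being a boundary. *)
Lemma cokernel_exists : exists (A : zmodType) (q : {additive V -> A}),
  forall v, q v = 0 <-> exists u, v = f u.
Proof.
exists (Quotient.quot image_pred), (\pi_(Quotient.quot image_pred)) => v.
have -> : (\pi_(Quotient.quot image_pred) v = 0) <-> v \in image_pred.
  have -> : (v \in image_pred) = (v - 0 \in image_pred) by rewrite subr0.
  by rewrite Quotient.idealrBE raddf0; split=> /eqP.
by split=> [/asboolP|H]; [|apply/asboolP].
Qed.

End Cokernel.

Lemma homology_pi_eq (C : chain_complex) n (x y : cycles C n) :
  \pi_(homology C n) x = \pi_(homology C n) y <->
  exists c, cycle_val x - cycle_val y = bd C n c.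
Proof.
have -> : (\pi_(homology C n) x = \pi_(homology C n) y) <-> x - y \in @boundary_pred C n.
  by rewrite Quotient.idealrBE; split=> /eqP.
have <- : cycle_val (x - y) = cycle_val x - cycle_val y.
  exact: (raddfB (\val : cycles C n -> C n)).
by split=> [/asboolP|H]; [|apply/asboolP].
Qed.

Section HomologyIso.
Variables (C D : chain_complex) (n : nat).
Variable f : {additive C n -> D n}.
Hypothesis f_cycle : forall z, bd_out C n z = 0 -> bd_out D n (f z) = 0.
Hypothesis f_boundary : forall z, bd_out C n z = 0 ->
  (exists c, f z = bd D n c) <-> exists c, z = bd C n c.
Hypothesis f_onto : forall d : D n, bd_out D n d = 0 ->
  exists z c, bd_out C n z = 0 /\ d = f z + bd D n c.

(** The hypotheses make the map induced by [f] well defined, injective and surjective in the single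
    degree [n]; [f] is not asked to be part of a chain map. *)
Lemma homology_iso : zmod_iso (homology C n) (homology D n).
Proof.
have fP (z : cycles C n) : f (cycle_val z) \in @cycle_pred D n.
  by rewrite inE f_cycle//; apply/eqP; exact: cycle_valP.
pose g z := Cycle (fP z).
have gP (x y : cycles C n) : \pi_(homology D n) (g x) = \pi_(homology D n) (g y) <->
    \pi_(homology C n) x = \pi_(homology C n) y.
  rewrite !homology_pi_eq /= -(raddfB f); apply: f_boundary.
  by rewrite raddfB !(eqP (cycle_valP _)) subr0.
have piC (x : homology C n) : \pi_(homology C n) (repr x) = x by exact: reprK.
have piD (x : homology D n) : \pi_(homology D n) (repr x) = x by exact: reprK.
pose F (x : homology C n) : homology D n := \pi_(homology D n) (g (repr x)).
have FB : zmod_morphism F.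
  move=> x y; rewrite /F -raddfB.
  transitivity (\pi_(homology D n) (g (repr x - repr y))).
    by apply/gP; rewrite raddfB !piC; congr (_ - _); apply/esym; exact: piC.
  by congr (\pi_(homology D n) _); apply: val_inj; rewrite /= raddfB.
pose FA := GRing.isZmodMorphism.Build _ _ F FB.
pose Fa : {additive homology C n -> homology D n} :=
  HB.pack_for {additive homology C n -> homology D n} F FA.
exists Fa => /=.
rewrite -setTT_bijective; split=> //.
- by move=> x y _ _ /gP; rewrite !piC.
- move=> y _; have /f_onto[z [c [z0 yE]]] := eqP (cycle_valP (repr y)).
  have zP : z \in @cycle_pred C n by rewrite inE z0.
  exists (\pi_(homology C n) (Cycle zP)) => //; rewrite -[RHS]piD.
  transitivity (\pi_(homology D n) (g (Cycle zP))); first by apply/gP; rewrite piC.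
  apply/homology_pi_eq; exists (- c); rewrite yE /= raddfN.
  by rewrite opprD addrA subrr add0r.
Qed.

End HomologyIso.

Lemma RP2_bd1 (c : {ffun cell RP2 1 -> int}) : cell_bd c = 0.
Proof. by apply/ffunP => v; rewrite !ffunE big1// => e _ /=; rewrite subrr mulr0. Qed.

Lemma RP2_bd2 (c : {ffun cell RP2 2 -> int}) e : cell_bd c e = c tt * 2.
Proof.
rewrite ffunE (big_pred1 tt) /=; last by case.
by case: e; rewrite !big_cons big_nil.
Qed.

Lemma trivial_homology_iso (C D : chain_complex) n :
  (forall z : C n, bd_out C n z = 0 -> z = 0) ->
  (forall z : D n, bd_out D n z = 0 -> z = 0) ->
  zmod_iso (homology C n) (homology D n).
Proof.
move=> C0 D0; apply: (@homology_iso C D n \0) => /= [z _|z /C0 ->|d /D0 ->].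
- exact: raddf0.
- by split=> _; exists 0; rewrite raddf0.
- by exists 0, 0; rewrite !raddf0 addr0.
Qed.

(** * Homology deduced from the form of the 1-cocycles *)

Section CellularCochains.
Variable X : cw2.

Definition delta n (x : cell X n) : {ffun cell X n -> int} :=
  [ffun y => (x == y)%:R].

Lemma chain_sum_delta n (c : {ffun cell X n -> int}) :
  c = \sum_x delta x *~ c x.
Proof.
apply/ffunP => y; rewrite sum_ffunE (bigD1 y)//= big1 => [|x xy].
  by rewrite addr0 ffunMzE ffunE eqxx intz.
by rewrite ffunMzE ffunE (negPf xy) mul0rz.
Qed.

Lemma cell_bd_delta n (y : cell X n.+1) x : cell_bd (delta y) x = incidence y x.
Proof.
rewrite ffunE (bigD1 y)//= ffunE eqxx mul1r big1 ?addr0// => z zy.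
by rewrite ffunE eq_sym (negPf zy) mul0r.
Qed.

Definition dart_value (A : zmodType) (phi : edge X -> A) (a : edge X * bool) : A :=
  if a.2 then phi a.1 else - phi a.1.

Definition cocycle (A : zmodType) (phi : edge X -> A) :=
  forall f, \sum_(a <- attach f) dart_value phi a = 0.

Lemma cell_bd_delta_edge (e : edge X) :
  cell_bd (delta (e : cell X 1)) = delta (tgt e : cell X 0) - delta (src e : cell X 0).
Proof. by apply/ffunP => v; rewrite cell_bd_delta !ffunE. Qed.

Lemma cell_bd_delta_face (f : face X) :
  cell_bd (delta (f : cell X 2)) =
  \sum_(a <- attach f) dart_value (fun e => delta (e : cell X 1)) a.
Proof.
apply/ffunP => e; rewrite cell_bd_delta sum_ffunE /= big_mkcond /=.
apply: eq_bigr => -[e' b] _; rewrite /dart_value /=.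
by case: b; rewrite !ffunE; case: eqVneq => // _; rewrite oppr0.
Qed.

Lemma sum_incidence_face (A : zmodType) (phi : edge X -> A) (f : face X) :
  \sum_e phi e *~ incidence (f : cell X 2) e = \sum_(a <- attach f) dart_value phi a.
Proof.
under eq_bigr => e _ do rewrite mulrz_sumr.
rewrite (exchange_big_dep predT)//=; apply: eq_bigr => -[e b] _ /=.
rewrite (big_pred1 e) => [|y]; last by rewrite eq_sym.
by rewrite /dart_value; case: b => //=; rewrite mulrNz.
Qed.

Lemma bd_edge0 (c : {ffun edge X -> int}) v :
  cell_bd (c : {ffun cell X 1 -> int}) v = \sum_e c e * ((tgt e == v)%:R - (src e == v)%:R).
Proof. by rewrite ffunE. Qed.

(** Any two vertices are joined by a walk of positive even length, stated as an induction principle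
    over walks of length two. *)
Hypothesis even_walk : forall E : vert X -> vert X -> Prop,
  (forall x y z, E x y -> E y z -> E x z) ->
  (forall a b, dart_end (@src X) (@tgt X) a = dart_start (@src X) (@tgt X) b ->
     E (dart_start (@src X) (@tgt X) a) (dart_end (@src X) (@tgt X) b)) ->
  forall v w, E v w.
(** Since [c] is its own opposite, this form is compatible with reversing the orientation of
    edges. *)
Hypothesis cocycleP : forall (A : zmodType) (phi : edge X -> A), cocycle phi ->
  exists alpha c, c + c = 0 /\ forall e, phi e = alpha (tgt e) - alpha (src e) + c.
Hypothesis even_attach : forall f : face X, ~~ odd (size (attach f)).
Variable e0 : edge X.

Lemma edge_const_vert (A : Type) (g : vert X -> A) :
  (forall e, g (src e) = g (tgt e)) -> forall v w, g v = g w.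
Proof.
move=> gE; apply: even_walk => [x y z -> //|[a []] [b []]];
  by rewrite /dart_start /dart_end /= => E; rewrite ?gE ?E -?gE ?E ?gE.
Qed.

Lemma sum_bd_edge (c : {ffun edge X -> int}) :
  \sum_v cell_bd (c : {ffun cell X 1 -> int}) v = 0.
Proof.
under eq_bigr do rewrite bd_edge0.
rewrite exchange_big big1//= => e _; rewrite -mulr_sumr sumrB.
have one (v : vert X) : \sum_w (v == w)%:R = 1 :> int.
  by rewrite (bigD1 v)//= eqxx big1 ?addr0// => w /negPf; rewrite eq_sym => ->.
by rewrite !one subrr mulr0.
Qed.

(** Modulo boundaries all vertices have one class, so the class of a 0-chain is its total
    coefficient times that class. *)
Lemma boundary0P (c : {ffun vert X -> int}) :
  (exists d, (c : {ffun cell X 0 -> int}) = cell_bd d) <-> \sum_v c v = 0.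
Proof.
split=> [[d ->]|c0]; first exact: sum_bd_edge.
have [A [q Hq]] := cokernel_exists (@cell_bd X 0).
apply/Hq; rewrite (chain_sum_delta (c : {ffun cell X 0 -> int})) raddf_sum.
pose g (v : vert X) := q (delta (v : cell X 0)).
have gE : forall v w, g v = g w.
  apply: edge_const_vert => e; apply/eqP; rewrite eq_sym -subr_eq0 -raddfB.
  by apply/eqP/Hq; exists (delta (e : cell X 1)); rewrite /= cell_bd_delta_edge.
transitivity (\sum_v g (src e0) *~ c v); last by rewrite -mulrz_sumr c0.
by apply: eq_bigr => v _; rewrite raddfMz -(gE v).
Qed.

(* Modulo boundaries an edge [e] is [alpha (tgt e) - alpha (src e) + k], so a
   cycle is the sum of its coefficients times [k], and [k + k = 0]. *)
Lemma even_cycle_boundary (z : {ffun edge X -> int}) k :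
  cell_bd (z : {ffun cell X 1 -> int}) = 0 -> \sum_e z e = k * 2 ->
  exists d, (z : {ffun cell X 1 -> int}) = cell_bd d.
Proof.
move=> z0 zk.
have [A [q Hq]] := cokernel_exists (@cell_bd X 1).
pose phi (e : edge X) := q (delta (e : cell X 1)).
have [|alpha [c [cc phiE]]] := @cocycleP A phi.
  move=> f; transitivity (q (cell_bd (delta (f : cell X 2)))); last by apply/Hq; eexists.
  rewrite cell_bd_delta_face raddf_sum; apply: eq_bigr => -[e []] _ //=.
  by rewrite /dart_value /= raddfN.
apply/Hq; rewrite (chain_sum_delta (z : {ffun cell X 1 -> int})) raddf_sum.
transitivity (\sum_e (alpha (tgt e) - alpha (src e)) *~ z e + c *~ (\sum_e z e)).
  rewrite mulrz_sumr -big_split/=; apply: eq_bigr => e _.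
  by rewrite raddfMz -/(phi e) phiE mulrzDl.
rewrite zk mulrC mulrzA [c *~ 2]cc mul0rz addr0.
(* Summation by parts: the sum pairs [alpha] with the boundary of [z], which is 0. *)
transitivity (\sum_v alpha v *~ cell_bd (z : {ffun cell X 1 -> int}) v); last first.
  by rewrite big1// => v _; rewrite z0 ffunE mulr0z.
under [RHS]eq_bigr => v _ do rewrite bd_edge0 mulrz_sumr.
rewrite [RHS]exchange_big/=; apply: eq_bigr => e _.
under eq_bigr => v _ do rewrite mulrC mulrzA mulrzBr.
rewrite -mulrz_suml sumrB.
have one (v : vert X) : \sum_w alpha w *~ (v == w)%:R = alpha v.
  rewrite (bigD1 v)//= eqxx mulr1z big1 ?addr0// => w /negPf.
  by rewrite eq_sym => ->; rewrite mulr0z.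
by rewrite !one.
Qed.

(** Each face is attached along an even number of darts, each contributing 1 or -1 to the total. *)
Lemma boundary1_even (d : {ffun face X -> int}) :
  exists k, \sum_e cell_bd (d : {ffun cell X 2 -> int}) e = k * 2.
Proof.
have ev (s : seq (edge X * bool)) : exists k,
    \sum_(a <- s) (if a.2 then 1 else -1) = (size s)%:Z - k * 2.
  elim: s => [|a s [k IH]]; first by exists 0; rewrite big_nil.
  exists (if a.2 then k else k + 1); rewrite big_cons IH /=.
  by rewrite intS; case: a.2; ring.
have odd_free f : exists k, \sum_e incidence (f : cell X 2) e = k * 2 :> int.
  have [k Hk] := ev (attach f); exists ((size (attach f))./2%:Z - k).
  have := sum_incidence_face (fun=> 1 : int) f; rewrite /dart_value.
  under eq_bigr do rewrite intz.
  move=> ->; rewrite Hk; have := odd_double_half (size (attach f)).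
  by rewrite (negPf (even_attach f)) add0n => {1}<-; rewrite -muln2 PoszM; lia.
have [k Hk] := boolp.choice odd_free.
exists (\sum_f d f * k f); under eq_bigr do rewrite ffunE.
rewrite exchange_big mulr_suml; apply: eq_bigr => f _ /=.
by rewrite -mulr_sumr Hk mulrA.
Qed.

(** The edge [e0] is closed up by a chain of even total leading from its target back to its
    source. *)
Lemma odd_cycle_exists : exists (z : {ffun edge X -> int}) k,
  cell_bd (z : {ffun cell X 1 -> int}) = 0 /\ \sum_e z e = k * 2 + 1.
Proof.
pose E v w := exists (z : {ffun edge X -> int}) k,
  cell_bd (z : {ffun cell X 1 -> int}) = delta (w : cell X 0) - delta (v : cell X 0) /\
  \sum_e z e = k * 2.
have sumD (c : {ffun edge X -> int}) (d : {ffun edge X -> int}) :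
    \sum_e (c + d) e = \sum_e c e + \sum_e d e.
  by rewrite -big_split; apply: eq_bigr => e _; rewrite ffunE.
have sum_delta e : \sum_x delta (e : cell X 1) x = 1.
  rewrite (bigD1 e)//= ffunE eqxx big1 ?addr0// => x.
  by rewrite ffunE eq_sym => /negPf ->.
have [z [k [zE zk]]] : E (tgt e0) (src e0).
  apply: even_walk => [x y w [z [k [zE zk]]] [z' [k' [z'E z'k]]]|a b ab].
    exists (z + z'), (k + k'); rewrite raddfD /= zE z'E sumD zk z'k; split; last by ring.
    by rewrite addrC subrKA.
  pose dz (a : edge X * bool) : {ffun edge X -> int} :=
    dart_value (fun e => delta (e : cell X 1)) a.
  have dzE a' : cell_bd (dz a' : {ffun cell X 1 -> int}) =
      delta (dart_end (@src X) (@tgt X) a' : cell X 0) -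
      delta (dart_start (@src X) (@tgt X) a' : cell X 0).
    case: a' => e []; rewrite /dz /dart_value /dart_end /dart_start /= ?raddfN /= cell_bd_delta_edge//.
    by rewrite opprB.
  have dz1 a' : exists k, \sum_e dz a' e = k * 2 + 1.
    case: a' => e []; rewrite /dz /dart_value /=; first by exists 0; rewrite sum_delta.
    exists (-1); under eq_bigr do rewrite ffunE.
    by rewrite sumrN sum_delta.
  have [k Hk] := dz1 a; have [k' Hk'] := dz1 b.
  exists (dz a + dz b), (k + k' + 1); rewrite raddfD /= !dzE ab sumD Hk Hk'.
  by split; [rewrite addrC subrKA|ring].
exists (z + delta (e0 : cell X 1)), k; rewrite sumD zk sum_delta; split=> //.
by rewrite raddfD /= zE cell_bd_delta_edge subrKA subrr.
Qed.

(** The comparison map to the projective plane in degrees 0 and 1; in degree 1 the parity of the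
    total detects the class of a cycle. *)
Definition total n m (c : {ffun cell X n -> int}) : {ffun cell RP2 m -> int} :=
  [ffun => \sum_x c x].

Lemma total_additive n m : zmod_morphism (@total n m).
Proof.
move=> c d; apply/ffunP => x; rewrite !ffunE -sumrB.
by apply: eq_bigr => y _; rewrite !ffunE.
Qed.

HB.instance Definition _ n m :=
  GRing.isZmodMorphism.Build _ _ (@total n m) (@total_additive n m).

Lemma RP2_iso0 : zmod_iso (integral_homology X 0) (integral_homology RP2 0).
Proof.
apply: (@homology_iso (cellular_chains X) (cellular_chains RP2) 0 (@total 0 0))
  => [z _|z _|d _] //.
  split=> [[c cE]|H].
    apply/boundary0P; have := congr1 (fun g : {ffun cell RP2 0 -> int} => g tt) cE.
    by rewrite /= ffunE RP2_bd1 ffunE.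
  exists 0; rewrite raddf0; apply/ffunP => x; rewrite !ffunE; exact/boundary0P.
exists (delta (src e0 : cell X 0) *~ (d : {ffun cell RP2 0 -> int}) tt), 0; split=> //.
rewrite raddf0 addr0; apply/ffunP => -[]; rewrite ffunE.
under eq_bigr do rewrite ffunMzE.
rewrite -mulrz_suml (bigD1 (src e0))//= ffunE eqxx big1 ?addr0 ?intz// => x.
by rewrite ffunE eq_sym => /negPf ->.
Qed.

Lemma RP2_iso1 : zmod_iso (integral_homology X 1) (integral_homology RP2 1).
Proof.
apply: (@homology_iso (cellular_chains X) (cellular_chains RP2) 1 (@total 1 1))
  => [z _|z z0|d _] //=; first exact: RP2_bd1.
  split=> [[c cE]|[d ->]].
    apply: (even_cycle_boundary z0 (k := (c : {ffun cell RP2 2 -> int}) tt)).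
    have := congr1 (fun g : {ffun cell RP2 1 -> int} => g tt) cE.
    by rewrite /= ffunE RP2_bd2.
  have [k Hk] := boundary1_even d; exists [ffun => k].
  by apply/ffunP => x; rewrite RP2_bd2 !ffunE.
have [z [k [z0 zk]]] := odd_cycle_exists.
pose m := (d : {ffun cell RP2 1 -> int}) tt.
(* The cycle [z *~ m] has total [m + m * k * 2], and the boundary of the 2-chain with coefficient
   [- (m * k)] removes the excess. *)
exists (z *~ m), [ffun => - (m * k)]; split.
  transitivity (cell_bd (z : {ffun cell X 1 -> int}) *~ m); last by rewrite z0 mul0rz.
  exact: (raddfMz (@cell_bd X 0)).
apply/ffunP => -[]; rewrite ffunE raddfMz ffunMzE ffunE zk RP2_bd2 ffunE -/m.
by rewrite mulrzz; ring.
Qed.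

Lemma RP2_iso_trivial n :
  zmod_iso (integral_homology X n.+3) (integral_homology RP2 n.+3).
Proof. by apply: trivial_homology_iso => z _; apply/ffunP; case. Qed.

(** There are no 3-cells, so degree 2 homology is the group of 2-cycles, which is trivial for the
    projective plane. *)
Lemma RP2_iso2P : zmod_iso (integral_homology X 2) (integral_homology RP2 2) <->
  forall c : {ffun cell X 2 -> int}, cell_bd c = 0 -> c = 0.
Proof.
have R0 (c : {ffun cell RP2 2 -> int}) : cell_bd c = 0 -> c = 0.
  move=> /ffunP/(_ tt); rewrite RP2_bd2 ffunE => /eqP.
  by rewrite mulf_eq0 orbF => /eqP H; apply/ffunP => -[]; rewrite H ffunE.
split=> [[f f_bij] z z0|H]; last exact: trivial_homology_iso.
have zP : z \in @cycle_pred (cellular_chains X) 2 by rewrite inE; apply/eqP; exact: z0.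
have : \pi_(homology (cellular_chains X) 2) (Cycle zP) =
       \pi_(homology (cellular_chains X) 2) 0.
  apply: (bij_inj f_bij).
  have triv (x y : homology (cellular_chains RP2) 2) : x = y.
    have piD (w : homology (cellular_chains RP2) 2) :
      \pi_(homology (cellular_chains RP2) 2) (repr w) = w by exact: reprK.
    rewrite -(piD x) -(piD y); congr (\pi_(homology (cellular_chains RP2) 2) _).
    apply: val_inj; rewrite /=.
    by rewrite (R0 _ (eqP (cycle_valP (repr x)))) (R0 _ (eqP (cycle_valP (repr y)))).
  exact: triv.
move=> /homology_pi_eq[c]; rewrite /= => zc.
have c0 : cell_bd (c : {ffun cell X 3 -> int}) = 0.
  by apply/ffunP => x; rewrite !ffunE big1//; case.
by rewrite c0 in zc; move/eqP: zc; rewrite subr_eq add0r => /eqP.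
Qed.

(** * Rational ranks and the Euler characteristic *)

Section Ranks.

(** Chains are row vectors: multiplying by this matrix is the boundary over the rationals, and by
    its transpose the coboundary. *)
Definition incidence_mx n : 'M[rat]_(#|cell X n.+1|, #|cell X n|) :=
  \matrix_(i, j) (incidence (enum_val i) (enum_val j))%:~R.

Lemma chain_mulE n (u : 'rV_#|cell X n.+1|) x : (u *m incidence_mx n) 0 (enum_rank x) =
  \sum_y u 0 (enum_rank y) * (incidence y x)%:~R.
Proof.
rewrite mxE (reindex (@enum_rank (cell X n.+1)))/=; last exact/onW_bij/enum_rank_bij.
by apply: eq_bigr => y _; rewrite mxE !enum_rankK.
Qed.

Lemma cochain_mulE n (u : 'rV_#|cell X n|) y : (u *m (incidence_mx n)^T) 0 (enum_rank y) =
  \sum_x u 0 (enum_rank x) *~ incidence y x.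
Proof.
rewrite mxE (reindex (@enum_rank (cell X n)))/=; last exact/onW_bij/enum_rank_bij.
by apply: eq_bigr => x _; rewrite !mxE !enum_rankK mulrzr.
Qed.

Lemma row_enumP (T : finType) (u w : 'rV[rat]_#|T|) :
  (forall x, u 0 (enum_rank x) = w 0 (enum_rank x)) -> u = w.
Proof. by move=> H; apply/rowP => j; rewrite -(enum_valK j). Qed.

Lemma sum_incidence_edge (A : zmodType) (g : vert X -> A) (e : edge X) :
  \sum_v g v *~ incidence (e : cell X 1) (v : cell X 0) = g (tgt e) - g (src e).
Proof.
have one (v : vert X) : \sum_w g w *~ (v == w)%:R = g v.
  rewrite (bigD1 v)//= eqxx mulr1z big1 ?addr0// => w /negPf.
  by rewrite eq_sym => ->; rewrite mulr0z.
by under eq_bigr => v _ do rewrite mulrzBr; rewrite sumrB !one.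
Qed.

Let M1 := incidence_mx 0.
Let M2 := incidence_mx 1.

(** By connectedness, the 0-cochains with zero coboundary are the constants. *)
Lemma rank_incidence1 : (\rank M1 + 1 = #|vert X|)%N.
Proof.
pose c1 : 'rV[rat]_#|vert X| := const_mx 1.
have kE : (kermx M1^T :=: c1)%MS.
  apply/eqmxP/andP; split.
    apply/rV_subP => u /sub_kermxP uM.
    have uE (e : edge X) : u 0 (enum_rank (src e : cell X 0)) = u 0 (enum_rank (tgt e : cell X 0)).
      have := cochain_mulE u (e : cell X 1).
      rewrite -/M1 uM mxE (sum_incidence_edge (fun v : vert X => u 0 (enum_rank (v : cell X 0)))).
      by move/esym/eqP; rewrite subr_eq0 => /eqP.
    have uc := @edge_const_vert rat (fun v : vert X => u 0 (enum_rank (v : cell X 0))) uE.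
    apply/sub_rVP; exists (u 0 (enum_rank (src e0 : cell X 0))); apply/row_enumP => v.
    by rewrite !mxE mulr1; exact: uc.
  apply/sub_kermxP/row_enumP => e.
  rewrite cochain_mulE (sum_incidence_edge (fun v : vert X => c1 0 (enum_rank (v : cell X 0)))).
  by rewrite !mxE subrr.
have : \rank (kermx M1^T) = 1%N.
  rewrite kE rank_rV; case: eqVneq => // /rowP/(_ (enum_rank (src e0 : cell X 0))).
  by rewrite !mxE => /eqP; rewrite oner_eq0.
have : (\rank M1 <= #|cell X 0|)%N by rewrite -mxrank_tr; exact: rank_leq_row.
rewrite mxrank_ker mxrank_tr -[#|vert X|]/(#|cell X 0|); lia.
Qed.

(** Rational 1-cocycles are coboundaries, because [c + c = 0] forces [c = 0]. *)
Lemma rank_incidence2 : (\rank M2 + \rank M1 = #|edge X|)%N.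
Proof.
have kE : (kermx M2^T :=: M1^T)%MS.
  apply/eqmxP/andP; split; last first.
    apply/sub_kermxP; rewrite -trmx_mul; apply/eqP; rewrite trmx_eq0; apply/eqP.
    apply/row_matrixP => i; rewrite row_mul row0; apply/row_enumP => v.
    rewrite chain_mulE [RHS]mxE.
    transitivity ((\sum_y incidence (enum_val i : cell X 2) y *
      incidence y (v : cell X 0))%:~R : rat); last by rewrite incidence_comp.
    by rewrite rmorph_sum; apply: eq_bigr => y _; rewrite !mxE enum_rankK rmorphM.
  apply/rV_subP => u /sub_kermxP uM.
  pose phi (e : edge X) := u 0 (enum_rank (e : cell X 1)).
  have [|alpha [c [cc phiE]]] := @cocycleP rat phi.
    move=> f; rewrite -sum_incidence_face.
    by have := cochain_mulE u (f : cell X 2); rewrite -/M2 uM mxE => <-.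
  have {}c0 : c = 0 by lra.
  apply/submxP; exists (\row_j alpha (enum_val j)); apply/row_enumP => e.
  rewrite cochain_mulE -/(phi e) phiE c0 addr0 -(sum_incidence_edge alpha).
  by apply: eq_bigr => v _; rewrite mxE enum_rankK.
have : (\rank M2 <= #|cell X 1|)%N by rewrite -mxrank_tr; exact: rank_leq_row.
have := mxrank_ker M2^T; rewrite kE !mxrank_tr -[#|edge X|]/(#|cell X 1|); lia.
Qed.

Lemma integral_kernel_row_free :
  (forall c : {ffun cell X 2 -> int}, cell_bd c = 0 -> c = 0) <-> row_free M2.
Proof.
split=> [H|/row_free_inj H c c0].
  rewrite -kermx_eq0; apply/rowV0P => u /sub_kermxP uM.
  (* Denominators are cleared: [numq] times the product [d x] of the other denominators is the entry
     times the product [D] of all of them. *)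
  pose d (x : cell X 2) := \prod_(y | y != x) denq (u 0 (enum_rank y)).
  pose c := [ffun x : cell X 2 => numq (u 0 (enum_rank x)) * d x].
  pose D := \prod_y denq (u 0 (enum_rank (y : cell X 2))).
  have D0 : (D%:~R : rat) != 0.
    by rewrite intr_eq0; apply/prodf_neq0 => y _; exact: denq_neq0.
  have cE x : (c x)%:~R = u 0 (enum_rank x) * D%:~R.
    rewrite ffunE /D (bigD1 x)//= -/(d x) !rmorphM /= mulrA; congr (_ * _).
    exact: numqE.
  have c0 : c = 0.
    apply: H; apply/ffunP => e; apply: (@intr_inj rat); rewrite !ffunE rmorph_sum /=.
    have := chain_mulE u (e : cell X 1); rewrite -/M2 uM mxE => /esym uE.
    transitivity (0 * D%:~R : rat); last by rewrite mul0r.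
    rewrite -[X in _ = X * _]uE mulr_suml; apply: eq_bigr => y _.
    by rewrite rmorphM /= cE mulrAC.
  apply/row_enumP => x; rewrite mxE; apply: (mulIf D0).
  by rewrite -cE c0 ffunE mul0r.
have : (\row_j (c (enum_val j))%:~R : 'rV[rat]_#|cell X 2|) = 0.
  apply: H; rewrite mul0mx; apply/row_enumP => e; rewrite chain_mulE mxE.
  transitivity ((cell_bd c e)%:~R : rat); last by rewrite c0 ffunE.
  rewrite ffunE rmorph_sum; apply: eq_bigr => y _.
  by rewrite mxE enum_rankK rmorphM.
move=> /rowP cz; apply/ffunP => x; have := cz (enum_rank x).
by rewrite !mxE enum_rankK ffunE => /eqP; rewrite intr_eq0 => /eqP.
Qed.

End Ranks.

(** Only degree 2 can differ. The rank formulas turn the alternating sum into the number of faces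
    minus the rank of the second boundary, which is 0 exactly when that boundary is injective. *)
Theorem RP2_homology_iff :
  (forall i, zmod_iso (integral_homology X i) (integral_homology RP2 i)) <->
  #|vert X|%:Z - 1 - #|edge X|%:Z + #|face X|%:Z = 0.
Proof.
have r1 := rank_incidence1; have r2 := rank_incidence2.
transitivity (row_free (incidence_mx 1)).
  rewrite -integral_kernel_row_free -RP2_iso2P; split=> [/(_ 2)//|H].
  by move=> [|[|[|n]]]; [exact: RP2_iso0|exact: RP2_iso1| |exact: RP2_iso_trivial].
rewrite /row_free -[#|cell X 2|]/(#|face X|).
move: (\rank (incidence_mx 1)) (\rank (incidence_mx 0)) r1 r2 => a b <- <-.
by split=> [/eqP ->|H]; [lia|apply/eqP; lia].
Qed.

End CellularCochains.

(** * Polytopes as convex hulls of their vertices *)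

Local Open Scope fset_scope.
Local Open Scope ring_scope.

Section Convexity.
Variable R : realType.
Local Notation point := 'rV[R]_3.

(* Gordan's alternative; the induction eliminates the first vector [d x],
   replacing the others by their projections to the kernel of [dotp u]. *)
Lemma gordan (I : choiceType) (r : seq I) (d : I -> point) : uniq r ->
  (exists l : I -> R, [/\ forall i, i \in r -> 0 <= l i,
     0 < \sum_(i <- r) l i & \sum_(i <- r) l i *: d i = 0]) \/
  exists u, forall i, i \in r -> 0 < dotp u (d i).
Proof.
elim: r d => [|x r IH] d /=; first by move=> _; right; exists 0.
move=> /andP[xr r_uniq].
have lb (f : I -> R) : (forall i, i \in r -> 0 < f i) ->
    exists e, 0 < e /\ forall i, i \in r -> e <= f i.
  move=> f0; have [|e [e0 He]] := @finite_lower_bound R (seq_sub r) predT (fun i => f (ssval i)).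
    by move=> [i ir] _; exact: f0.
  by exists e; split=> // i ir; exact: (He (SeqSub ir)).
have neq i : i \in r -> (i == x) = false by apply: contraTF => /eqP ->.
have [[l [l0 lp ld]]|[u Hu]] := IH d r_uniq.
  left; exists (fun i => if i == x then 0 else l i).
  rewrite !big_cons eqxx add0r scale0r add0r; split.
  - by move=> i; rewrite inE; case: eqVneq => //= _; exact: l0.
  - by rewrite big_seq; under eq_bigr => i ir do rewrite neq//; rewrite -big_seq.
  - by rewrite big_seq; under eq_bigr => i ir do rewrite neq//; rewrite -big_seq.
case: (ltP 0 (dotp u (d x))) => [ux|].
  by right; exists u => i; rewrite inE => /predU1P[->|/Hu].
case: (eqVneq (d x) 0) => [dx0 _|dx0].
  left; exists (fun i => if i == x then 1 else 0).
  rewrite !big_cons eqxx dx0 scaler0 add0r; split.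
  - by move=> i _; case: ifP.
  - by rewrite ltr_pwDl// big_seq sumr_ge0// => i _; case: ifP.
  - by rewrite big_seq big1// => i ir; rewrite neq// scale0r.
rewrite le_eqVlt => /predU1P[ux|ux].
  (* Here [u] vanishes on [d x]: adding a large multiple of [u] to [d x] makes the other vectors
     positive without affecting [d x]. *)
  have [e [e0 He]] : exists e, 0 < e /\ forall i, i \in r ->
      e <= dotp u (d i) / (1 + `|dotp (d x) (d i)|).
    by apply: lb => i /Hu ?; rewrite divr_gt0// ltr_pwDl.
  right; exists (d x + e^-1 *: u) => i; rewrite inE dotpDl dotpZl => /predU1P[->|ir].
    by rewrite ux mulr0 addr0 dotp_gt0.
  have := He i ir; rewrite ler_pdivlMr; last by rewrite ltr_pwDl.
  move=> H.
  suff : 1 + `|dotp (d x) (d i)| <= e^-1 * dotp u (d i).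
    have := ler_norm (- dotp (d x) (d i)); rewrite normrN; lra.
  by rewrite ler_pdivlMl.
have [[l [l0 lp ld]]|[w Hw]] := IH (fun i => dotp u (d i) *: d x - dotp u (d x) *: d i) r_uniq.
  left; exists (fun i => if i == x then \sum_(i <- r) l i * dotp u (d i)
    else - dotp u (d x) * l i).
  have s0 : 0 <= \sum_(i <- r) l i * dotp u (d i).
    by rewrite big_seq sumr_ge0// => i ir; rewrite mulr_ge0 ?l0// ltW ?Hu.
  rewrite !big_cons eqxx; split.
  - move=> i; rewrite inE; case: eqVneq => //= _ ir.
    by rewrite mulr_ge0 ?l0// oppr_ge0 ltW.
  - rewrite ltr_wpDl//.
    rewrite big_seq; under eq_bigr => i ir do rewrite neq//.
    by rewrite -big_seq -mulr_sumr mulr_gt0// oppr_gt0.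
  - rewrite -[RHS]ld scaler_suml [X in _ + X]big_seq; under eq_bigr => i ir do rewrite neq//.
    rewrite -big_seq -big_split/=; apply: eq_bigr => i _.
    by rewrite scalerBr !scalerA mulNr scaleNr [l i * dotp u (d x)]mulrC.
(* [w + a *: u] vanishes on [d x] and is positive on the others; subtracting a small [e *: u] makes
   it positive on [d x] too, as [dotp u (d x)] is negative. *)
pose a := dotp w (d x) / - dotp u (d x).
have aE : a * dotp u (d x) = - dotp w (d x).
  by rewrite /a invrN mulrN mulNr divfK// lt_eqF.
have [e [e0 He]] : exists e, 0 < e /\ forall i, i \in r ->
    e <= (a + dotp w (d i) / dotp u (d i)) / 2.
  apply: lb => i ir; rewrite divr_gt0//; have ui := Hu i ir.
  rewrite -(pmulr_lgt0 _ ui) mulrDl divfK ?gt_eqF//.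
  have Nux : 0 < - dotp u (d x) by rewrite oppr_gt0.
  rewrite -(pmulr_lgt0 _ Nux); have := Hw i ir; rewrite dotpBr !dotpZr.
  have -> : (a * dotp u (d i) + dotp w (d i)) * - dotp u (d x) =
     - (a * dotp u (d x)) * dotp u (d i) - dotp u (d x) * dotp w (d i) by ring.
  by rewrite aE opprK [dotp w (d x) * _]mulrC.
right; exists (w + (a - e) *: u) => i; rewrite inE dotpDl dotpZl => /predU1P[->|ir].
  rewrite mulrBl aE addrA subrr add0r oppr_gt0 pmulr_rlt0//.
have ui := Hu i ir; have := He i ir; rewrite ler_pdivlMr// => H.
have : e < a + dotp w (d i) / dotp u (d i) by lra.
by rewrite -(ltr_pM2r ui) mulrDl divfK ?gt_eqF// mulrBl; lra.
Qed.

Lemma conv_fset_dotp_le (S : {fset point}) u c x :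
  (forall s, s \in S -> dotp u s <= c) -> conv_fset S x -> dotp u x <= c.
Proof.
move=> Sc [l [l0 l1 ->]]; rewrite dotp_suml -[leRHS]mul1r -l1 mulr_suml.
by rewrite big_seq [leRHS]big_seq; apply: ler_sum => s sS; rewrite ler_wpM2l ?l0 ?Sc.
Qed.

(** The deficits [c - dotp u t], weighted by [l], are nonnegative and sum to 0, so weights vanish
    off the face. *)
Lemma conv_fset_face (S : {fset point}) u c (l : point -> R) :
  (forall s, s \in S -> dotp u s <= c) ->
  (forall s, s \in S -> 0 <= l s) -> \sum_(s <- S) l s = 1 ->
  dotp u (\sum_(s <- S) l s *: s) = c ->
  forall s, s \in S -> dotp u s < c -> l s = 0.
Proof.
move=> Sc l0 l1 uc s sS us.
have H0 : \sum_(t <- S) l t * (c - dotp u t) = 0.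
  under eq_bigr do rewrite mulrBr.
  by rewrite sumrB -mulr_suml l1 mul1r -dotp_suml uc subrr.
have ge0 t : t \in S -> 0 <= l t * (c - dotp u t).
  by move=> tS; rewrite mulr_ge0 ?l0// subr_ge0 Sc.
have : l s * (c - dotp u s) = 0.
  apply/eqP; rewrite eq_le ge0// andbT -H0 (big_fsetD1 s)//= lerDl.
  by rewrite big_seq sumr_ge0// => t; rewrite !inE => /andP[_ /ge0].
by move=> /eqP; rewrite mulf_eq0 subr_eq0 (gt_eqF us) orbF => /eqP.
Qed.

Lemma conv_fsetS (S S' : {fset point}) : S `<=` S' ->
  (conv_fset S `<=` conv_fset S')%classic.
Proof.
move=> SS' x [l [l0 l1 ->]]; exists (fun s => if s \in S then l s else 0).
have E (V : nmodType) (F : point -> V) : (forall s, s \notin S -> F s = 0) ->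
    \sum_(s <- S') F s = \sum_(s <- S) F s.
  move=> F0; rewrite (big_fsetID _ (mem S))/= [X in _ + X]big1_fset ?addr0.
    apply: eq_fbigl => s; rewrite !inE /=; case: (boolP (s \in S)) => sS.
      by rewrite (fsubsetP SS').
    by rewrite andbF.
  by move=> s; rewrite !inE => /andP[_ /F0].
split.
- by move=> s _; case: ifP => // /l0.
- rewrite E; last by move=> s /negPf ->.
  by rewrite -l1 big_seq [RHS]big_seq; apply: eq_bigr => s ->.
- rewrite [RHS]E; last by move=> s /negPf ->; rewrite scale0r.
  by rewrite big_seq [RHS]big_seq; apply: eq_bigr => s ->.
Qed.

Lemma conv_fset_convex (S : {fset point}) x y :
  conv_fset S x -> conv_fset S y -> (segment x y `<=` conv_fset S)%classic.
Proof.
move=> [l [l0 l1 ->]] [m [m0 m1 ->]] _ [t [t0 t1 ->]].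
exists (fun s => (1 - t) * l s + t * m s); split.
- by move=> s sS; rewrite addr_ge0// mulr_ge0 ?l0 ?m0// subr_ge0.
- by rewrite big_split/= -!mulr_sumr l1 m1 !mulr1 subrK.
- rewrite !scaler_sumr -big_split/=; apply: eq_bigr => s _.
  by rewrite [RHS]scalerDl !scalerA.
Qed.

Lemma conv_fsetD1 (S : {fset point}) s : s \in S -> conv_fset (S `\ s) s ->
  conv_fset (S `\ s) = conv_fset S.
Proof.
move=> sS [m [m0 m1 sE]]; apply/seteqP; split.
  by apply: conv_fsetS; exact: fsubD1set.
move=> x [l [l0 l1 ->]]; exists (fun t => l s * m t + l t); split.
- move=> t tS; rewrite addr_ge0//; first by rewrite mulr_ge0 ?m0 ?l0.
  by apply: l0; move: tS; rewrite !inE => /andP[].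
- by rewrite big_split/= -mulr_sumr m1 mulr1 -(big_fsetD1 s sS).
- have E : l s *: s = \sum_(t <- S `\ s) (l s * m t) *: t.
    transitivity (l s *: (\sum_(t <- S `\ s) m t *: t)); first by congr (_ *: _).
    by rewrite scaler_sumr; apply: eq_bigr => t _; rewrite scalerA.
  rewrite (big_fsetD1 s sS)/= E -big_split/=.
  by apply: eq_bigr => t _; rewrite scalerDl.
Qed.

(** Gordan's alternative for the differences [s - t]: a dependency would write [s] as a convex
    combination of the other points, and otherwise [u] exposes [s]. *)
Lemma conv_fset_vertex (S : {fset point}) s : s \in S -> ~ conv_fset (S `\ s) s ->
  is_vertex (conv_fset S) s.
Proof.
move=> sS nconv.
have [[l [l0 lp ld]]|[u Hu]] := @gordan _ (S `\ s) (fun t => s - t) (fset_uniq _).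
  case: nconv; pose L := \sum_(t <- S `\ s) l t.
  have Ln0 : L != 0 by rewrite gt_eqF.
  exists (fun t => L^-1 * l t); split.
  - by move=> t /l0 ?; rewrite mulr_ge0// invr_ge0 ltW.
  - by rewrite -mulr_sumr mulVf.
  - apply: (scalerI Ln0); rewrite scaler_sumr.
    under eq_bigr do rewrite scalerA mulrA mulfV// mul1r.
    apply/eqP; rewrite -subr_eq0 scaler_suml -sumrB -[eqbRHS]ld; apply/eqP.
    by apply: eq_bigr => t _; rewrite scalerBr.
have le t : t \in S -> dotp u t <= dotp u s.
  move=> tS; case: (eqVneq t s) => [->//|ts]; have := Hu t.
  by rewrite !inE ts tS dotpBr subr_gt0 => /(_ isT)/ltW.
exists u, (dotp u s); split; first by move=> x; exact: conv_fset_dotp_le.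
apply/seteqP; split=> [_ ->|x [[l [l0 l1 xE]]]]; first by split=> //; exact: sub_conv_fset.
move=> ux; have H := conv_fset_face le l0 l1; rewrite -xE in H.
have {}H t : t \in S `\ s -> l t = 0.
  rewrite !inE => /andP[ts tS]; apply: H => //.
  by have := Hu t; rewrite !inE ts tS dotpBr subr_gt0; apply.
rewrite xE (big_fsetD1 s sS)/=; move: l1; rewrite (big_fsetD1 s sS)/=.
rewrite big1_fset => [|t tS _]; last exact: H.
rewrite addr0 => ->; rewrite scale1r big1_fset ?addr0// => t tS _.
by rewrite H// scale0r.
Qed.

Lemma vertex_in_fset (S : {fset point}) v : is_vertex (conv_fset S) v -> v \in S.
Proof.
move=> [u [c [le_c vE]]].
have [[l [l0 l1 vl]] uv] : conv_fset S v /\ dotp u v = c.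
  by have : [set v]%classic v by []; rewrite vE.
have [s sS ls] : exists2 s, s \in S & l s != 0.
  apply: contrapT => H; move: l1; rewrite big1_fset => [/esym/eqP|s sS _].
    by rewrite oner_eq0.
  by apply/eqP; apply: contraT => ls; case: H; exists s.
have Sc t : t \in S -> dotp u t <= c by move=> tS; apply/le_c/sub_conv_fset.
suff <- : s = v by [].
suff : [set x | conv_fset S x /\ dotp u x = c]%classic s by rewrite -vE.
split; first exact: sub_conv_fset.
apply/eqP; rewrite eq_le Sc// leNgt; apply: contra ls => us; apply/eqP.
by apply: (conv_fset_face Sc l0 l1 _ sS us); rewrite -vl.
Qed.

Variables (P : set point) (hP : convex_polyhedron P).

(** Generators lying in the hull of the others are discarded one by one; the remaining ones are
    vertices. *)
Lemma conv_vertex_set : P = conv_fset (vertex_set P).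
Proof.
have [[S PS] _] := hP.
suff [S' [PS' S'V]] : exists S', P = conv_fset S' /\ forall s, s \in S' -> is_vertex P s.
  apply/seteqP; split.
    by rewrite {1}PS'; apply: conv_fsetS; apply/fsubsetP => s /S'V /(vertex_setP hP).
  rewrite {2}PS'; apply: conv_fsetS; apply/fsubsetP => s /(vertex_setP hP).
  by rewrite {1}PS' => /vertex_in_fset.
have [n] := ubnP #|` S|; elim: n => // n IH in S PS *; rewrite ltnS => Sn.
case: (pselect (exists2 s, s \in S & conv_fset (S `\ s) s)) => [[s sS sconv]|H].
  apply: (IH (S `\ s)); first by rewrite conv_fsetD1.
  by apply: leq_trans Sn; rewrite (cardfsD1 s S) sS.
exists S; split=> // s sS; rewrite PS; apply: conv_fset_vertex => // sconv.
by apply: H; exists s.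
Qed.

End Convexity.

(** * Edges and antipodality in terms of maximizing vertices *)

Section PolyhedronVertices.
Variables (R : realType) (P : set 'rV[R]_3) (hP : convex_polyhedron P).
Local Notation T := (vertex_set P : finType).
Local Notation pt := (fun v : T => val v).
Local Notation G := (maximizers pt).
Implicit Types (u : 'rV[R]_3) (v w : T).

Lemma vertex_sub v : P (val v).
Proof. apply: vertex_in; apply/(vertex_setP hP); exact: fsvalP. Qed.

Lemma polyhedron_dotp_le u c x :
  (forall v, dotp u (val v) <= c) -> P x -> dotp u x <= c.
Proof.
move=> H; rewrite (conv_vertex_set hP) /=; apply: conv_fset_dotp_le => s sV.
exact: (H [` sV]).
Qed.

Lemma vertices_exposed v : exists a, G a = [set v]%SET.
Proof.
have /(vertex_setP hP)[a [c [le_c vE]]] := fsvalP v; exists a.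
have av : dotp a (val v) = c.
  by have : [set val v]%classic (val v) by []; rewrite vE => -[].
apply/setP => w; rewrite finset.in_set1; apply/idP/eqP => [|->].
  move=> /maximizersP/(_ v) vw; apply: val_inj.
  suff : [set val v]%classic (val w) by [].
  rewrite vE; split; first exact: vertex_sub.
  apply/eqP; rewrite eq_le; apply/andP; split; first by apply: le_c; exact: vertex_sub.
  by rewrite -av.
by apply/maximizersP => x; rewrite av; apply: le_c; exact: vertex_sub.
Qed.

Lemma vertices_inhabited : inhabited T.
Proof.
have [_ [x /nbhs_singleton Px]] := hP.
have [l [_ l1 _]] : conv_fset (vertex_set P) x by rewrite -(conv_vertex_set hP).
case: (fset_0Vmem (vertex_set P)) => [V0|[v vV]]; last by constructor; exact: [` vV].
by move: l1; rewrite V0 big_seq_fset0 => /esym/eqP; rewrite oner_eq0.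
Qed.

Lemma vertices_full_dim u :
  (forall v w, dotp u (val v) = dotp u (val w)) -> u = 0.
Proof.
move=> H; have [v0] := vertices_inhabited; apply/eqP; apply: contraT => u0.
case: (width_gt0 hP (a := dotp u (val v0)) u0) => z Pz.
apply/eqP; rewrite eq_le polyhedron_dotp_le//=; last by move=> v; rewrite (H v v0).
rewrite -lerN2 -!dotpNl; apply: polyhedron_dotp_le => // v.
by rewrite !dotpNl (H v v0).
Qed.

(** The slab conditions need checking on vertices only. The direction changes sign, as [antipodal]
    puts its first point on the lower plane and [opposite] among the maximizers. *)
Lemma antipodal_opposite v w : antipodal P (val v) (val w) <-> opposite pt v w.
Proof.
split=> [[u [a [b [u0 slab [_ va] [_ wb]]]]]|[u u0 [/maximizersP vG /maximizersNP wG]]].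
  exists (- u); first by rewrite oppr_eq0.
  rewrite opprK; split.
    by apply/maximizersNP => x; have /slab/andP[] := vertex_sub x; rewrite va.
  by apply/maximizersP => x; have /slab/andP[] := vertex_sub x; rewrite wb.
exists (- u), (- dotp u (val v)), (- dotp u (val w)); rewrite oppr_eq0 !dotpNl.
split=> // [z Pz||]; [|by split=> //; exact: vertex_sub..].
rewrite dotpNl !lerN2 polyhedron_dotp_le//=.
by rewrite -lerN2 -!dotpNl; apply: polyhedron_dotp_le => // x; rewrite !dotpNl lerN2.
Qed.

(** The weights of a point of the face vanish off [v] and [v'], so the point lies on the segment,
    with the weight of [v'] as parameter. *)
Lemma maximizers_edge a v v' : v != v' -> G a = [set v; v']%SET ->
  is_edge P [fset val v; val v'].
Proof.
move=> vv' Ga; exists (val v), (val v'); rewrite val_eqE; split=> //.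
- apply/(vertex_setP hP); exact: fsvalP.
- apply/(vertex_setP hP); exact: fsvalP.
have vG : v \in G a by rewrite Ga finset.set21.
have v'G : v' \in G a by rewrite Ga finset.set22.
exists a, (dotp a (val v)).
have le (x : T) : dotp a (val x) <= dotp a (val v) by move/maximizersP: vG => /(_ x).
split=> [x|]; first exact: (polyhedron_dotp_le le).
have av' := maximizers_eq vG v'G.
apply/seteqP; split=> [x xs|x [Px]].
  split.
    have := @conv_fset_convex R (vertex_set P) (val v) (val v').
    rewrite -(conv_vertex_set hP) => H.
    by apply: H xs; exact: vertex_sub.
  case: xs => t [_ _ ->]; rewrite dotpDr !dotpZr -av' -mulrDl subrK mul1r//.
have [l [l0 l1 xE]] : conv_fset (vertex_set P) x by rewrite -(conv_vertex_set hP).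
move=> ax.
have Sc s : s \in vertex_set P -> dotp a s <= dotp a (val v) by move=> sV; exact: (le [` sV]).
have lz s : s \in vertex_set P -> s != val v -> s != val v' -> l s = 0.
  move=> sV sv sv'; apply: (conv_fset_face Sc l0 l1 _ sV); first by rewrite -xE.
  rewrite lt_neqAle Sc// andbT; apply/eqP => E.
  have : [` sV] \in G a by apply: (maximizers_trans vG); rewrite /= E.
  rewrite Ga finset.in_set2 => /orP[] /eqP Ev.
    by case/eqP: sv; rewrite -Ev.
  by case/eqP: sv'; rewrite -Ev.
have big2 (V : nmodType) (F : 'rV[R]_3 -> V) :
    (forall s, s \in vertex_set P -> s != val v -> s != val v' -> F s = 0) ->
    \sum_(s <- vertex_set P) F s = F (val v) + F (val v').
  move=> F0; rewrite (big_fsetD1 (val v) (fsvalP v))/=.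
  rewrite (big_fsetD1 (val v'))/=; last by rewrite !inE val_eqE eq_sym vv' (fsvalP v').
  rewrite big1_fset ?addr0// => s; rewrite !inE => /and3P[? ? ?] _; exact: F0.
move: l1; rewrite big2// => l1; exists (l (val v')); split.
- exact: l0 (fsvalP v').
- by rewrite -l1 lerDr; exact: l0 (fsvalP v).
- rewrite xE big2; last by move=> s sV sv sv'; rewrite lz// scale0r.
  by rewrite -l1 addrK.
Qed.

(** The two edges, hence their midpoints, lie in the supporting planes orthogonal to [u]. This
    provides the 2-cell for each square relation required of a cocycle. *)
Lemma antipodal_edges_exist u a b v v' w w' : u != 0 -> v != v' -> w != w' ->
  G a = [set v; v']%SET -> G b = [set w; w']%SET ->
  G a \subset G u -> G b \subset G (- u) ->
  [fset [fset val v; val v']; [fset val w; val w']] \in antipodal_edge_pairs P.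
Proof.
move=> u0 vv' ww' Ga Gb sub subN; apply/antipodal_edge_pairsP.
have vG : v \in G u by apply: (fintype.subsetP sub); rewrite Ga finset.set21.
have v'G : v' \in G u by apply: (fintype.subsetP sub); rewrite Ga finset.set22.
have wG : w \in G (- u) by apply: (fintype.subsetP subN); rewrite Gb finset.set21.
have w'G : w' \in G (- u) by apply: (fintype.subsetP subN); rewrite Gb finset.set22.
exists [fset val v; val v'], [fset val w; val w']; split=> //.
- apply/(edge_setP hP); exact: (maximizers_edge vv' Ga).
- apply/(edge_setP hP); exact: (maximizers_edge ww' Gb).
- apply/eqP => E; have : val v \in [fset val w; val w'] by rewrite -E fset21.
  rewrite !inE !val_eqE => /orP[] /eqP vw.
    have : opposite pt v w by exists u.
    by move/(opposite_neq vertices_full_dim); rewrite vw eqxx.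
  have : opposite pt v w' by exists u.
  by move/(opposite_neq vertices_full_dim); rewrite vw eqxx.
have Pmid x y : P (2^-1 *: (val (x : T) + val (y : T))).
  have := @conv_fset_convex R (vertex_set P) (val x) (val y).
  rewrite -(conv_vertex_set hP) => H; apply: (H (vertex_sub x) (vertex_sub y)).
  by exists 2^-1; split; [lra|lra|rewrite scalerDr; congr (_ *: _ + _); lra].
rewrite !midpointE ?val_eqE//.
exists (- u), (- dotp u (val v)), (- dotp u (val w)); rewrite oppr_eq0 !dotp_midpoint !dotpNl.
rewrite -(maximizers_eq vG v'G).
have := maximizers_eq wG w'G; rewrite !dotpNl => <-.
move/maximizersP: vG => vG; move/maximizersNP: wG => wG.
split=> // [z Pz||]; [|by split=> //; lra..].
rewrite dotpNl !lerN2 polyhedron_dotp_le//=.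
by rewrite -lerN2 -!dotpNl; apply: polyhedron_dotp_le => // x; rewrite !dotpNl lerN2.
Qed.

End PolyhedronVertices.

(** * The antipodal square complex *)

Lemma fset2_eq (K : choiceType) (a b c d : K) : a != b ->
  [fset a; b] = [fset c; d] -> (a = c /\ b = d) \/ (a = d /\ b = c).
Proof.
move=> ab E; have : a \in [fset c; d] by rewrite -E fset21.
have : b \in [fset c; d] by rewrite -E fset22.
by rewrite !inE => /orP[] /eqP bE /orP[] /eqP aE; subst; rewrite ?eqxx in ab; auto.
Qed.

Lemma square_sum (A : zmodType) (a b c d : A) : a + (- b + (d - c)) = 0 -> a - b = c - d.
Proof. by move=> /eqP; rewrite addrA addr_eq0 opprB => /eqP. Qed.

Lemma transpose_difference (A : zmodType) (a b c d : A) :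
  - a - - b = - c - - d -> a - c = b - d.
Proof.
rewrite !opprK ![- _ + _]addrC => E.
apply/eqP; rewrite -subr_eq0 opprB [a - c]addrC addrACA [- c + d]addrC -E.
by rewrite subrKA subrr.
Qed.

(** The relation says that a mixed second difference vanishes, which survives exchanging the ends of
    either pair. The attaching path of a face comes with its own order of the ends. *)
Lemma mixed_difference_eq (K : choiceType) (S : {fset K}) (A : zmodType)
    (f : S -> S -> A) (v v' w w' x x' y y' : S) :
  val v != val v' -> val w != val w' ->
  [fset val v; val v'] = [fset val x; val x'] ->
  [fset val w; val w'] = [fset val y; val y'] ->
  f x y - f x' y = f x y' - f x' y' -> f v w - f v' w = f v w' - f v' w'.
Proof.
have sw (a1 a2 a3 a4 : A) : a1 - a2 = a3 - a4 -> a2 - a1 = a4 - a3.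
  by move=> E; rewrite -opprB E opprB.
move=> nv nw /(fset2_eq nv) Ev /(fset2_eq nw) Ew E.
case: Ev => -[/val_inj -> /val_inj ->]; case: Ew => -[/val_inj -> /val_inj ->] //.
- by apply: sw.
- by apply/esym/sw.
Qed.

Section SquareComplexCocycles.
Variables (R : realType) (P : set 'rV[R]_3) (hP : convex_polyhedron P).
Local Notation T := (vertex_set P : finType).
Local Notation pt := (fun v : T => val v).
Local Notation X := (square_complex hP).
Local Notation start := (dart_start (@sc_src R P) (@sc_tgt R P)).
Local Notation stop := (dart_end (@sc_src R P) (@sc_tgt R P)).

Lemma sc_orientP (e : edge X) : sc_src e != sc_tgt e /\
  val e = [fset val (sc_src e); val (sc_tgt e)].
Proof. exact: (svalP (cid (orientation_exists e))). Qed.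

Lemma sc_edge_opposite (e : edge X) : opposite pt (sc_src e) (sc_tgt e).
Proof.
apply/(antipodal_opposite hP).
have /antipodal_vertex_pairsP[v [w [_ _ vw Avw E]]] := fsvalP e.
have [ne E'] := sc_orientP e; rewrite [val e]E in E'.
by case: (fset2_eq vw E') => -[<- <-] //; exact: antipodal_sym.
Qed.

Lemma opposite_dart v w : opposite pt v w -> exists a, start a = v /\ stop a = w.
Proof.
move=> vw; apply: dart_exists; first exact: (opposite_neq (vertices_full_dim hP) vw).
exact/(antipodal_opposite hP).
Qed.

(** The ends of a dart give its edge, since the 1-skeleton is a simple graph, and being distinct
    they give its direction. *)
Lemma dart_unique (a b : edge X * bool) : start a = start b -> stop a = stop b -> a = b.
Proof.
have ends (c : edge X * bool) : val c.1 = [fset val (start c); val (stop c)] /\ start c != stop c.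
  have [ne E] := sc_orientP c.1; case: c ne E => e []; rewrite /dart_start /dart_end //= => ne E.
  by rewrite E fsetUC eq_sym.
move=> sE tE; have [Ea na] := ends a; have [Eb _] := ends b.
have e1 : a.1 = b.1 by apply: val_inj; rewrite Ea Eb sE tE.
case: a b e1 sE tE na {Ea Eb} => e c [e' c'] /= -> {e}.
rewrite /dart_start /dart_end; case: c; case: c' => //= -> _; by rewrite eqxx.
Qed.

(** * Cocycles as antisymmetric functions of vertex pairs *)

Section Cocycle.
Variables (A : zmodType) (phi : edge X -> A).

(** The value 0 is a default for pairs that are not joined by a dart. *)
Definition pair_value (v w : T) : A :=
  if [pick a | (start a == v) && (stop a == w)] is Some a then dart_value phi a else 0.

Lemma pair_value_dart a : pair_value (start a) (stop a) = dart_value phi a.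
Proof.
rewrite /pair_value; case: pickP => [b /andP[/eqP sb /eqP tb]|/(_ a)].
  by rewrite (dart_unique sb tb).
by rewrite !eqxx.
Qed.

Lemma pair_value_rev a : pair_value (stop a) (start a) = - dart_value phi a.
Proof.
case: a => e b; have := pair_value_dart (e, ~~ b).
by case: b; rewrite /dart_start /dart_end /dart_value /= ?opprK.
Qed.

Lemma pair_value_antisym v w : opposite pt v w -> pair_value w v = - pair_value v w.
Proof. by move=> /opposite_dart[a [<- <-]]; rewrite pair_value_dart pair_value_rev. Qed.

Hypothesis phiP : cocycle phi.

Lemma attach_square (q : face X) : exists x x' y y' : T,
  val q = [fset [fset val x; val x']; [fset val y; val y']] /\
  pair_value x y - pair_value x' y = pair_value x y' - pair_value x' y'.
Proof.
case: (sc_attachP hP q) => x [x' [y [y' [qE]]]].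
move: (phiP q : \sum_(a <- sc_attach hP q) dart_value phi a = 0).
case: (sc_attach hP q) => [|a1 [|a2 [|a3 [|a4 []]]]] //= + [s1 s2 s3 s4] [t1 t2 t3 t4].
move=> phi0; exists x, x', y, y'; split; first exact: qE.
move: phi0; rewrite !big_cons big_nil addr0.
have -> : dart_value phi a4 = - pair_value x y'.
  by rewrite -[LHS]opprK -pair_value_rev s4 t4.
have -> : dart_value phi a3 = pair_value x' y' by rewrite -pair_value_dart s3 t3.
have -> : dart_value phi a2 = - pair_value x' y.
  by rewrite -[LHS]opprK -pair_value_rev s2 t2.
have -> : dart_value phi a1 = pair_value x y by rewrite -pair_value_dart s1 t1.
exact: square_sum.
Qed.

Lemma pair_value_square u a b v v' w w' : u != 0 -> v != v' -> w != w' ->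
  maximizers pt a = [set v; v']%SET -> maximizers pt b = [set w; w']%SET ->
  maximizers pt a \subset maximizers pt u -> maximizers pt b \subset maximizers pt (- u) ->
  pair_value v w - pair_value v' w = pair_value v w' - pair_value v' w'.
Proof.
move=> u0 vv' ww' Ga Gb sub subN.
have qP := antipodal_edges_exist hP u0 vv' ww' Ga Gb sub subN.
have opp x y : x \in [set v; v']%SET -> y \in [set w; w']%SET -> opposite pt x y.
  move=> xG yG; exists u => //; split.
    by apply: (fintype.subsetP sub); rewrite Ga.
  by apply: (fintype.subsetP subN); rewrite Gb.
have vw : opposite pt v w by apply: opp; rewrite ?finset.set21.
have vw' : opposite pt v w' by apply: opp; rewrite ?finset.set21 ?finset.set22.
have v'w : opposite pt v' w by apply: opp; rewrite ?finset.set21 ?finset.set22.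
have v'w' : opposite pt v' w' by apply: opp; rewrite ?finset.set22.
have [x [x' [y [y' [/= qE]]]]] := attach_square [` qP].
have ef : [fset val v; val v'] != [fset val w; val w'].
  apply/eqP => E; have : val v \in [fset val w; val w'] by rewrite -E fset21.
  rewrite !inE !val_eqE => /orP[] /eqP vE.
    by move: (opposite_neq (vertices_full_dim hP) vw); rewrite vE eqxx.
  by move: (opposite_neq (vertices_full_dim hP) vw'); rewrite vE eqxx.
have nvv' : val v != val v' by rewrite val_eqE.
have nww' : val w != val w' by rewrite val_eqE.
case: (fset2_eq ef qE) => -[E1 E2] E.
  exact: (mixed_difference_eq nvv' nww' E1 E2 E).
(* The face lists the two edges in the other order; antisymmetry exchanges the arguments. *)
have := mixed_difference_eq nww' nvv' E2 E1 E.
rewrite !(pair_value_antisym vw, pair_value_antisym vw').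
rewrite !(pair_value_antisym v'w, pair_value_antisym v'w').
exact: transpose_difference.
Qed.

End Cocycle.

Lemma square_complex_cocycle (A : zmodType) (phi : edge X -> A) : cocycle phi ->
  exists alpha c, c + c = 0 /\ forall e, phi e = alpha (tgt e) - alpha (src e) + c.
Proof.
move=> phiP.
have [alpha [c [cc H]]] := antisymmetric_cocycle (vertices_exposed hP) (vertices_full_dim hP)
  (pair_value_square phiP) (@pair_value_antisym A phi).
(* The sign reflects the convention of target minus source, opposite to that of
   [antisymmetric_cocycle]. *)
exists (fun v => - alpha v), c; split=> // e.
rewrite opprK [- _ + _]addrC -H; last exact: sc_edge_opposite.
by rewrite -[LHS](pair_value_dart phi (e, true)).
Qed.

(** Vertices with a common opposite are joined by a walk of length two through it, so
    [opposite_connected] applies. *)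
Lemma square_complex_even_walk (E : vert X -> vert X -> Prop) :
  (forall x y z, E x y -> E y z -> E x z) ->
  (forall a b, dart_end (@src X) (@tgt X) a = dart_start (@src X) (@tgt X) b ->
     E (dart_start (@src X) (@tgt X) a) (dart_end (@src X) (@tgt X) b)) ->
  forall v w, E v w.
Proof.
move=> Etr EW; apply: (opposite_connected (vertices_exposed hP) Etr) => v v' w.
move=> /opposite_dart[a [<- aw]] /opposite_sym/opposite_dart[b [bw <-]].
by apply: EW; rewrite /= aw bw.
Qed.

Lemma square_complex_even_attach (q : face X) : ~~ odd (size (attach q)).
Proof.
have [x [x' [y [y' [_ sE _]]]]] := sc_attachP hP q.
by have := congr1 size sE; rewrite size_map /= => ->.
Qed.

Lemma square_complex_edge_exists : inhabited (edge X).
Proof.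
have [v] := vertices_inhabited hP.
have [w /opposite_dart[[e _] _]] := opposite_exists (vertices_exposed hP) v.
by constructor.
Qed.

End SquareComplexCocycles.

Theorem corollary1p4 (R : realType) (P : set 'rV[R]_3)
    (hP : convex_polyhedron P) :
  antipodal_defect P = 0 <->
  forall i : nat, zmod_iso (integral_homology (square_complex hP) i)
                           (integral_homology RP2 i).
Proof.
have [e] := square_complex_edge_exists hP.
rewrite (RP2_homology_iff (@square_complex_even_walk R P hP)
  (@square_complex_cocycle R P hP) (@square_complex_even_attach R P hP) e).
by rewrite /antipodal_defect !cardfE.
Qed.
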